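(* Any quasi-o-minimal ring with nonzero multiplication is an o-minimal expansion of a real closed field.
   Context: Structures are $L$-structures $\mathcal{M}=(M,<,\dots)$ for a first-order language $L$ containing $<$, where $<$ is a linear ordering of $M$. ''Definable'' means definable by a first-order formula with parameters; ''0-definable'' means definable without parameters. Intervals may have $\pm\infty$ as endpoints. $\mathcal{M}$ is o-minimal if its definable subsets (of $M$) are exactly the Boolean combinations of intervals with endpoints in $M$. $\mathcal{M}$ is quasi-o-minimal if for every $\mathcal{N}\equiv\mathcal{M}$ (with universe $N$) the definable subsets of $N$ are exactly the Boolean combinations of 0-definable subsets of $N$ and intervals with endpoints in $N$. ''Ring'' means an abelian group $(R,+)$ with a multiplication that is distributive over addition on both sides; associativity, commutativity and the existence of a unit are not assumed. A quasi-o-minimal ring is a quasi-o-minimal structure which is an ordered ring, possibly with extra structure: the linear order is invariant under addition, and $x\ge 0$, $y\ge 0$ imply $xy\ge 0$. ''Nonzero multiplication'' means that $ab\ne 0$ for some $a,b\in R$. The conclusion means that the ring $R$ with its addition, multiplication and order is a real closed (ordered) field and that the whole structure is o-minimal. *)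

(* Defs.v *)
From HB Require Import structures.
From mathcomp Require Import all_boot all_order all_algebra.
From mathcomp Require Import boolp classical_sets.

Set Implicit Arguments.
Unset Strict Implicit.
Unset Printing Implicit Defensive.

(* The symbols are given arity by arity: [functions L n] is the type of
   the n-ary function symbols, constants being those of arity 0. *)
Record language := Language {
  functions : nat -> Type;
  relations : nat -> Type }.

(* Formulas are well-scoped with de Bruijn indices: the variables of
   [term L n] and the free variables of [formula L n] range over 'I_n, and
   [All] binds the variable 0.  Sentences are thus formulas in [formula L 0]. *)
Inductive term (L : language) (n : nat) : Type :=
  | Var of 'I_n
  | App k of functions L k & ('I_k -> term L n).

Inductive formula (L : language) : nat -> Type :=
  | Fal n : formula L n
  | Eq n of term L n & term L n : formula L n
  | Rel n k of relations L k & ('I_k -> term L n) : formula L n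
  | Imp n of formula L n & formula L n : formula L n
  | All n of formula L n.+1 : formula L n.

Record structure (L : language) := Structure {
  carrier :> Type;
  fun_interp : forall k, functions L k -> k.-tuple carrier -> carrier;
  rel_interp : forall k, relations L k -> k.-tuple carrier -> Prop }.
Arguments fun_interp {L} M {k} f args : rename.
Arguments rel_interp {L} M {k} r args : rename.

Section Semantics.
Variables (L : language) (M : structure L).

Fixpoint eval n (e : n.-tuple M) (t : term L n) : M :=
  match t with
  | Var i => tnth e i
  | App _ f ts => fun_interp M f [tuple eval e (ts i) | i < _]
  end.

Fixpoint sat n (phi : formula L n) : n.-tuple M -> Prop :=
  match phi with
  | Fal _ => fun _ => False
  | Eq _ t u => fun e => eval e t = eval e u
  | Rel _ _ r ts => fun e => rel_interp M r [tuple eval e (ts i) | i < _]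
  | Imp _ phi psi => fun e => sat phi e -> sat psi e
  | All _ phi => fun e => forall x : M, sat phi [tuple of x :: e]
  end.

Definition definable : set (set M) := fun A =>
  exists n (phi : formula L n.+1) (p : n.-tuple M),
    A = [set x | sat phi [tuple of x :: p]]%classic.

Definition definable0 : set (set M) := fun A =>
  exists phi : formula L 1, A = [set x | sat phi [tuple x]]%classic.

Definition rel2 (r : relations L 2) (x y : M) : Prop :=
  rel_interp M r [tuple x; y].

Definition fun2 (f : functions L 2) (x y : M) : M :=
  fun_interp M f [tuple x; y].

End Semantics.
Arguments definable {L} M A.
Arguments definable0 {L} M A.
Arguments rel2 {L} M r x y.
Arguments fun2 {L} M f x y.

Definition elementarily_equivalent (L : language) (M N : structure L) : Prop :=
  forall phi : formula L 0, sat phi [tuple of [::] : seq M] <->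
                            sat phi [tuple of [::] : seq N].

Inductive boolean_combination (T : Type) (G : set (set T)) : set (set T) :=
  | BC_gen A of G A : boolean_combination G A
  | BC_setT : boolean_combination G setT
  | BC_setC A of boolean_combination G A : boolean_combination G (~` A)%classic
  | BC_setU A B of boolean_combination G A & boolean_combination G B :
      boolean_combination G (A `|` B)%classic.

Section Order.
Variables (T : Type) (lt : T -> T -> Prop).

Definition linear_order : Prop :=
  [/\ forall x, ~ lt x x,
      forall x y z, lt x y -> lt y z -> lt x z
    & forall x y, [\/ lt x y, x = y | lt y x]].

Definition le (x y : T) : Prop := x = y \/ lt x y.

(* [Infinite] is -oo as a left endpoint and +oo as a right endpoint. *)
Inductive endpoint := Infinite | Open of T | Closed of T.

Definition right_of (l : endpoint) (x : T) : Prop :=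
  match l with Infinite => True | Open a => lt a x | Closed a => le a x end.

Definition left_of (r : endpoint) (x : T) : Prop :=
  match r with Infinite => True | Open b => lt x b | Closed b => le x b end.

Definition is_interval : set (set T) := fun A =>
  exists l r, A = [set x | right_of l x /\ left_of r x]%classic.

(* Multiplication is not assumed associative, commutative or unital. *)
Definition ordered_ring (add mul : T -> T -> T) (zero : T) : Prop :=
  [/\ [/\ associative add, commutative add, left_id zero add
        & forall x, exists y, add y x = zero],
      left_distributive mul add /\ right_distributive mul add,
      linear_order,
      forall x y z, lt x y -> lt (add x z) (add y z)
    & forall x y, le zero x -> le zero y -> le zero (mul x y)].

(* [T] itself carries a structure of [rcfType] whose addition,
   multiplication and order are the given ones. *)
Definition real_closed_field (add mul : T -> T -> T) : Prop :=
  exists c : Num.RealClosedField T,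
    let F : rcfType := Num.RealClosedField.Pack c in
    [/\ forall x y : F, (x + y)%R = add x y,
        forall x y : F, (x * y)%R = mul x y
      & forall x y : F, (x < y)%R <-> lt x y].

End Order.

Definition o_minimal (L : language) (lt : relations L 2) (M : structure L) :
    Prop :=
  linear_order (rel2 M lt) /\
  forall A : set M,
    definable M A <-> boolean_combination (is_interval (rel2 M lt)) A.

Definition quasi_o_minimal (L : language) (lt : relations L 2)
    (M : structure L) : Prop :=
  linear_order (rel2 M lt) /\
  forall N : structure L, elementarily_equivalent N M ->
  forall A : set N,
    definable N A <->
    boolean_combination (definable0 N `|` is_interval (rel2 N lt))%classic A.

(* Main.v *)
Require Import Defs.
From HB Require Import structures.
From mathcomp Require Import all_boot all_order all_algebra.
From mathcomp Require Import boolp classical_sets filter.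
From mathcomp Require Import lra.
From Stdlib Require List.

(** Why the theorem is true.

    Quasi-o-minimality enters only through a uniform statement in R itself
    ([uniform_finiteness], by compactness through an ultrapower): for a
    definable family of sets F(a) there are finitely many 0-definable sets and
    a number m such that every F(a) is determined, off at most m points that
    cut the line, by membership in those sets.  This is repackaged as [tame]:
    one finite colouring tau of R with definable classes such that each F(a)
    is a union of colour classes on every interval avoiding its m points.

    Two consequences for an ordered abelian group V drive the proof.

    - [finitely_many_germs]: the sets F(a) have only finitely many germs at
      any given cut, in particular at infinity.

    - [no_gap]: a definable cut K realized by no element would, after
      translation, fall inside any interval whose length moves K, and there it
      separates the colours of its left side from those of its right side.  So
      an interval on one side shows strictly fewer colours.  If a length that
      moves K always splits into two that do, such an interval can again be
      taken with a length that moves K, and the descent never stops.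

    When V is divisible, lengths can be halved, hence V is definably complete
    ([divisible_complete]).  Also, for definable A the elements r for which
    A and A - r have the same germ at infinity form a subgroup of finite
    index, hence everything.  It follows that a nonzero definable subgroup is
    V ([definable_subgroup_trivial]: it is cofinal by completeness and it
    is the stabilizer of its own germ), and that definable sets are eventually
    constant ([divisible_eventually_constant]).

    In the ring, take a > 0 with aR nonzero.  The groups (n^i a)R = n^i (aR)
    are cofinal in the same cut, so two of them share a germ there and are
    therefore equal; since R is torsion-free, aR is n-divisible
    ([image_divisible]).  If the annihilator of a were nonzero, its upper end
    would be a gap whose moving lengths split, because R/Ann(a) = aR is
    2-divisible; so it is zero, and R is isomorphic to aR, hence divisible.
    Now definable subgroups are 0 or R.  Thus aR = R for all nonzero a, and if
    a e = a then { x | x e = x } contains a, so e is a right unit.  The left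
    unit law, associativity and commutativity are additive in one variable and
    hold at e, hence everywhere ([ring_is_field]).

    Finally let F be the resulting ordered field.  Definable completeness
    gives the intermediate value theorem for polynomials.  Through
    x |-> 1/(x - a), eventual constancy becomes constancy on an interval to
    the right of every point a, for definable sets and for colourings.  Hence
    the boundary B of a definable set is isolated on the right.  It is
    finite: were there m + 1 points b in B, a small shift d > 0 would put all
    the b + d where the colouring is constant to their right, whereas
    B + d can have at most m isolated points there.  A definable set is
    constant between consecutive boundary points, by completeness. *)

Set Implicit Arguments.
Unset Strict Implicit.
Unset Printing Implicit Defensive.

(** * Ultrapowers *)

Section Ultrapower.
Local Open Scope classical_set_scope.
Variables (L : language) (M : structure L) (I : Type) (U : set_system I).
Context {UU : UltraFilter U}.

Lemma ultraI (P Q : set I) : U P -> U Q -> U (P `&` Q).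
Proof. exact: filterI. Qed.

Lemma ultra_imp (P Q : set I) : (U P -> U Q) -> U [set i | P i -> Q i].
Proof.
move=> PQ; have [UP|UnP] := in_ultra_setVsetC P UU.
  by apply: filterS (PQ UP) => i Qi _.
by apply: filterS UnP => i nPi /nPi.
Qed.

Lemma ultra_iff (P Q : set I) : U [set i | P i <-> Q i] -> U P <-> U Q.
Proof.
by move=> PQ; split=> H; apply: filterS (ultraI PQ H) => i [[? ?]]; auto.
Qed.

Lemma ultra_finite (J : finType) (P : J -> set I) :
  (forall j, U (P j)) -> U [set i | forall j, P j i].
Proof.
move=> UP; suff: U [set i | forall j, j \in enum J -> P j i].
  by apply: filterS => i Pi j; apply: Pi; rewrite mem_enum.
elim: (enum J) => [|j s IH]; first by apply: filterS (@filterT _ U _).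
apply: filterS (ultraI (UP j) IH) => i [Pj Ps] k.
by rewrite inE => /orP[/eqP->|/Ps].
Qed.

(** Equality atoms are interpreted by Leibniz equality, so the ultrapower has
    to be an actual quotient: its elements are the equivalence classes
    themselves, and [repr] chooses a representative. *)
Definition germ (f : I -> M) : set (I -> M) := [set g | U [set i | f i = g i]].

Definition ultrapower_carrier := {A : set (I -> M) | exists f, A = germ f}.

Definition to_ultra (f : I -> M) : ultrapower_carrier :=
  exist _ (germ f) (ex_intro _ f erefl).

Definition repr (a : ultrapower_carrier) : I -> M := sval (cid (svalP a)).

Lemma germ_eq f g : germ f = germ g <-> U [set i | f i = g i].
Proof.
split=> [E|E].
  by have: germ g g by [apply: filterS (@filterT _ U _)]; rewrite -E.
rewrite predeqE => h; rewrite /germ /=; split=> H;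
  by apply: filterS (ultraI E H) => i /= [-> ->].
Qed.

Lemma to_ultra_eq f g : to_ultra f = to_ultra g <-> U [set i | f i = g i].
Proof.
split=> [/(congr1 sval)/germ_eq //|/germ_eq E].
rewrite /to_ultra; move: (ex_intro _ f _) (ex_intro _ g _).
by rewrite E => p q; rewrite (Prop_irrelevance p q).
Qed.

Lemma reprK a : to_ultra (repr a) = a.
Proof.
case: a => A H; rewrite /to_ultra /repr; case: cid => f /= E; move: H.
by rewrite E => H; congr exist; apply: Prop_irrelevance.
Qed.

Lemma repr_to_ultra f : U [set i | repr (to_ultra f) i = f i].
Proof. exact/to_ultra_eq/reprK. Qed.

Lemma ultra_eq a b : a = b <-> U [set i | repr a i = repr b i].
Proof. by rewrite -to_ultra_eq !reprK. Qed.

Definition at_index i n (e : n.-tuple ultrapower_carrier) : n.-tuple M :=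
  map_tuple (fun a => repr a i) e.

Definition ultrapower : structure L :=
  @Structure L ultrapower_carrier
    (fun k f args => to_ultra (fun i => fun_interp M f (at_index i args)))
    (fun k r args => U [set i | rel_interp M r (at_index i args)]).

Lemma at_index_cons i n x (e : n.-tuple ultrapower) :
  at_index i [tuple of x :: e] = [tuple of repr x i :: at_index i e].
Proof. exact/val_inj. Qed.

Lemma eval_ultrapower n (e : n.-tuple ultrapower) (t : term L n) :
  U [set i | repr (eval e t) i = eval (at_index i e) t].
Proof.
elim: t => [j|k f ts IH] /=.
  by apply: filterS (@filterT _ U _) => i _ /=; rewrite tnth_map.
set args := [tuple eval e (ts j) | j < k].
have R := repr_to_ultra (fun i => fun_interp M f (at_index i args)).
apply: filterS (ultraI R (ultra_finite IH)) => i /= [-> IHi].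
congr fun_interp; apply/eq_from_tnth => j; rewrite !tnth_map !tnth_ord_tuple.
exact: IHi.
Qed.

(** Los's theorem.  For a universal formula, if its instances fail at almost
    every index, the counterexamples chosen index by index form one element of
    the ultrapower at which it fails. *)
Lemma sat_ultrapower n (phi : formula L n) (e : n.-tuple ultrapower) :
  sat phi e <-> U [set i | sat phi (at_index i e)].
Proof.
elim: phi e => {n} [n|n t u|n k r ts|n phi IH psi IH'|n phi IH] e /=.
- by split=> // /filter_not_empty.
- rewrite ultra_eq; apply: ultra_iff.
  apply: filterS (ultraI (eval_ultrapower e t) (eval_ultrapower e u)).
  by move=> i /= [-> ->].
- apply: ultra_iff.
  apply: filterS (ultra_finite (fun j => eval_ultrapower e (ts j))) => i /= E.
  suff ->: at_index i [tuple eval e (ts j) | j < k] =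
           [tuple eval (at_index i e) (ts j) | j < k] by [].
  by apply/eq_from_tnth => j; rewrite !tnth_map !tnth_ord_tuple.
- rewrite IH IH'; split; first exact: ultra_imp.
  by move=> H H'; apply: filterS (ultraI H H') => i /= [HH /HH].
- split=> [H|H a].
  + have [//|/= UC] := in_ultra_setVsetC
      [set i | forall x, sat phi [tuple of x :: at_index i e]] UU.
    (* Indices without a counterexample get a junk value; it exists because M is
       inhabited as soon as one index has a counterexample. *)
    have cex i : exists x, (exists y, ~ sat phi [tuple of y :: at_index i e]) ->
        ~ sat phi [tuple of x :: at_index i e].
      have [[y Hy]|N] := pselect (exists y, ~ sat phi [tuple of y :: at_index i e]).
        by exists y.
      have /filter_ex[j /existsNP [y _]] := UC.
      by exists y => /N.
    have [f Hf] := choice cex.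
    have /IH U1 := H (to_ultra f).
    have UE := ultraI (ultraI UC U1) (repr_to_ultra f).
    have /filter_ex[i /= [[/existsNP/Hf nsat + E]]] := UE.
    by rewrite at_index_cons E.
  + rewrite IH; apply: filterS H => i /= /(_ (repr a i)).
    by rewrite at_index_cons.
Qed.

Lemma ultrapower_equivalent : elementarily_equivalent ultrapower M.
Proof.
move=> phi; rewrite sat_ultrapower.
have E i : at_index i [tuple of [::]] = [tuple of [::] : seq M] by exact/val_inj.
split=> [/filter_ex[i] /=|H]; first by rewrite E.
by apply: filterS (@filterT _ U _) => i _ /=; rewrite E.
Qed.

Lemma rel2_ultrapower (r : relations L 2) (a b : ultrapower) :
  rel2 ultrapower r a b <-> U [set i | rel2 M r (repr a i) (repr b i)].
Proof.
rewrite /rel2 /=; apply: ultra_iff; apply: filterS (@filterT _ U _) => i _ /=.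
by have ->: at_index i [tuple a; b] = [tuple repr a i; repr b i] by exact/val_inj.
Qed.

Lemma linear_order_ultrapower (r : relations L 2) :
  linear_order (rel2 M r) -> linear_order (rel2 ultrapower r).
Proof.
case=> irr tr tot; split.
- by move=> a; rewrite rel2_ultrapower => /filter_ex[i /irr].
- move=> a b c; rewrite !rel2_ultrapower => ab bc.
  by apply: filterS (ultraI ab bc) => i /= [/tr h /h].
- move=> a b; have [lt_ab|nlt] :=
    in_ultra_setVsetC [set i | rel2 M r (repr a i) (repr b i)] UU.
    by constructor 1; apply/rel2_ultrapower.
  have [eq_ab|neq] := in_ultra_setVsetC [set i | repr a i = repr b i] UU.
    by constructor 2; apply/ultra_eq.
  constructor 3; apply/rel2_ultrapower; apply: filterS (ultraI nlt neq) => i [].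
  by case: (tot (repr a i) (repr b i)).
Qed.

Lemma sat1_ultrapower (theta : formula L 1) (a : ultrapower) :
  sat theta [tuple a] <-> U [set i | sat theta [tuple repr a i]].
Proof.
rewrite sat_ultrapower; apply: ultra_iff; apply: filterS (@filterT _ U _).
move=> i _ /=.
by have ->: at_index i [tuple a] = [tuple repr a i] by exact/val_inj.
Qed.

End Ultrapower.
Arguments to_ultra {L} M {I} U f.
Arguments repr_to_ultra {L} M {I} U {UU} f.

(** * Uniform finiteness *)

(** The order type of a point over the finite set [zs]: all that intervals with
    endpoints in [zs] can see of it. *)
Definition same_side (T : Type) (lt : T -> T -> Prop) (zs : seq T) (x y : T) :=
  forall z, List.In z zs -> (lt x z <-> lt y z) /\ (x = z <-> y = z).

Definition agree L (M : structure L) (thetas : seq (formula L 1)) (x y : M) :=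
  forall theta, List.In theta thetas -> sat theta [tuple x] <-> sat theta [tuple y].

Lemma same_side_sub T (lt : T -> T -> Prop) zs zs' x y :
  (forall z, List.In z zs -> List.In z zs') ->
  same_side lt zs' x y -> same_side lt zs x y.
Proof. by move=> sub H z /sub/H. Qed.

Section BooleanCombinations.
Local Open Scope classical_set_scope.
Variables (T : Type) (lt : T -> T -> Prop).
Hypothesis lt_linear : linear_order lt.

Lemma same_side_gt zs x y z : List.In z zs -> same_side lt zs x y ->
  lt z x <-> lt z y.
Proof.
case: lt_linear => irr tr tot zs_z /(_ z zs_z)[lt_z eq_z].
have gtE a : lt z a <-> ~ lt a z /\ a <> z.
  split=> [za|[naz nEq]]; last by case: (tot a z).
  by split=> [/(tr _ _ _ za)/irr|E] //; rewrite E in za; case: (irr z).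
by rewrite !gtE lt_z eq_z.
Qed.

Lemma interval_same_side A : is_interval lt A ->
  exists zs, forall x y, same_side lt zs x y -> A x <-> A y.
Proof.
case=> [l [r ->]].
pose ends (e : endpoint T) :=
  match e with Infinite => [::] | Open a | Closed a => [:: a] end.
exists (ends l ++ ends r) => x y H.
have Hl : same_side lt (ends l) x y.
  by apply: (same_side_sub _ H) => z zl; apply: List.in_or_app; left.
have Hr : same_side lt (ends r) x y.
  by apply: (same_side_sub _ H) => z zl; apply: List.in_or_app; right.
have -> : ([set x | right_of lt l x /\ left_of lt r x] x) =
          (right_of lt l x /\ left_of lt r x) by [].
suff [-> ->] : (right_of lt l x <-> right_of lt l y) /\
               (left_of lt r x <-> left_of lt r y) by [].
split.
- case: l Hl {H} => [|a|a] //= Hl; have ina : List.In a [:: a] by left.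
    exact: same_side_gt Hl.
  rewrite /le (same_side_gt ina Hl); have [_ E] := Hl a ina.
  by split=> -[/esym/E/esym|]; auto.
- case: r Hr {H} => [|a|a] //= Hr; have [E1 E2] := Hr a (or_introl erefl) => //.
  by rewrite /le E1 E2.
Qed.

End BooleanCombinations.

(** A Boolean combination involves finitely many 0-definable sets and finitely
    many endpoints, and it cannot separate points that none of these separate. *)
Lemma boolean_combination_agree L (lt : relations L 2) (M : structure L) A :
  linear_order (rel2 M lt) ->
  boolean_combination (definable0 M `|` is_interval (rel2 M lt))%classic A ->
  exists thetas zs, forall x y,
    agree thetas x y -> same_side (rel2 M lt) zs x y -> A x <-> A y.
Proof.
move=> lin; elim=> {A} [A [[phi ->]|/(interval_same_side lin)[zs Hzs]]||
    A _ [ths [zs H]]|A B _ [ths [zs H]] _ [ths' [zs' H']]].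
- by exists [:: phi], [::] => x y /(_ phi (or_introl erefl)).
- by exists [::], zs => x y _; apply: Hzs.
- by exists [::], [::].
- by exists ths, zs => x y a s; rewrite /setC /= (H x y).
- exists (ths ++ ths'), (zs ++ zs') => x y a s.
  rewrite /setU /= (H x y) ?(H' x y) //.
  + by move=> th i; apply: a; apply: List.in_or_app; right.
  + by apply: (same_side_sub _ s) => z i; apply: List.in_or_app; right.
  + by move=> th i; apply: a; apply: List.in_or_app; left.
  + by apply: (same_side_sub _ s) => z i; apply: List.in_or_app; left.
Qed.

Section Uniform.
Local Open Scope classical_set_scope.
Variables (L : language) (lt : relations L 2) (R : structure L).
Hypothesis R_qom : quasi_o_minimal lt R.

Let index : Type := (seq (formula L 1) * nat)%type.

Let above (j : index) : set index := [set k |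
  (forall theta, List.In theta j.1 -> List.In theta k.1) /\ (j.2 <= k.2)%N].

Let exists_ultra : exists U : set_system index,
  UltraFilter U /\ forall j, U (above j).
Proof.
have FF : Filter (filter_from setT above).
  apply: filter_from_filter; first by exists ([::], 0%N).
  move=> i j _ _; exists (i.1 ++ j.1, maxn i.2 j.2) => // k [Hk1 Hk2].
  move: Hk2; rewrite geq_max => /andP[ik jk].
  by split; split=> // th thi; apply: Hk1; apply: List.in_or_app; auto.
have PF : ProperFilter (filter_from setT above).
  by apply: filter_from_proper => j _; exists j.
have [U [UU sub]] := ultraFilterLemma PF; exists U; split=> // j.
by apply: sub; exists j.
Qed.

(** Compactness.  If no finite data worked, then for each finite set of
    formulas and each m some parameter [p] would be bad.  Along an
    ultrafilter on the pairs (finite set, m) containing all upper cones, these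
    parameters define one in the ultrapower.  There the fibre is a Boolean
    combination involving finitely many formulas [ths] and endpoints [zs]; but
    above (ths, size zs) the bad parameters supply pairs that agree on
    these data and are separated by the fibre, and the two elements of the
    ultrapower that they form contradict Los's theorem. *)
Theorem uniform_finiteness n (phi : formula L n.+1) :
  exists thetas m, forall p : n.-tuple R, exists2 zs, (size zs <= m)%N &
    forall x y, agree thetas x y -> same_side (rel2 R lt) zs x y ->
      sat phi [tuple of x :: p] -> sat phi [tuple of y :: p].
Proof.
apply: contrapT => /forallNP N1.
pose bad (j : index) (p : n.-tuple R) := forall zs, (size zs <= j.2)%N ->
  exists xy : R * R, [/\ agree j.1 xy.1 xy.2, same_side (rel2 R lt) zs xy.1 xy.2,
    sat phi [tuple of xy.1 :: p] & ~ sat phi [tuple of xy.2 :: p]].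
have /choice[p badp] j : exists p, bad j p.
  have /forallNP/(_ j.2)/existsNP[p Hp] := N1 j.1.
  exists p => zs szs; apply: contrapT => Nxy; apply: Hp; exists zs => // x y a s sx.
  by apply: contrapT => nsy; apply: Nxy; exists (x, y).
have [U [UU Uabove]] := exists_ultra.
pose N := ultrapower R U.
pose P : n.-tuple N := [tuple to_ultra R U (fun j => tnth (p j) i) | i < n].
have P_at : U [set j | at_index j P = p j].
  have repr_p (i : 'I_n) := @repr_to_ultra _ R _ U UU (fun j => tnth (p j) i).
  apply: filterS (ultra_finite repr_p) => j H; apply/eq_from_tnth => i.
  by rewrite !tnth_map tnth_ord_tuple H.
have [lin qN] := R_qom; have linN := @linear_order_ultrapower _ R _ U UU lt lin.
have EN : elementarily_equivalent N R by exact: ultrapower_equivalent.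
have [defN _] := qN _ EN [set x | sat phi [tuple of x :: P]].
have [|ths [zs Nagree]] := boolean_combination_agree linN (defN _).
  by exists n, phi, P.
pose zs_at j := [seq repr z j | z <- zs].
have /choice[xy xyP] j : exists xy : R * R, above (ths, size zs) j ->
    [/\ agree ths xy.1 xy.2, same_side (rel2 R lt) (zs_at j) xy.1 xy.2,
      sat phi [tuple of xy.1 :: p j] & ~ sat phi [tuple of xy.2 :: p j]].
  have [ab|nab] := pselect (above (ths, size zs) j); last first.
    by have [xy _] := badp j [::] isT; exists xy => /nab.
  have [|xy [a s sx sy]] := badp j (zs_at j); first by rewrite size_map; case: ab.
  by exists xy => _; split=> // th /ab.1/a.
pose x : N := to_ultra R U (fun j => (xy j).1).
pose y : N := to_ultra R U (fun j => (xy j).2).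
have xyU : U [set j | [/\ at_index j P = p j, repr x j = (xy j).1,
    repr y j = (xy j).2 & above (ths, size zs) j]].
  apply: filterS (ultraI (ultraI P_at (Uabove (ths, size zs))) (ultraI
    (repr_to_ultra R U (fun j => (xy j).1)) (repr_to_ultra R U (fun j => (xy j).2)))).
  by move=> j [[E A] [Ex Ey]]; split.
have agree_xy : agree ths x y.
  move=> th ths_th; rewrite !sat1_ultrapower; apply: ultra_iff.
  by apply: filterS xyU => j [_ Ex Ey /xyP[a _ _ _]] /=; rewrite Ex Ey; apply: a.
have side_xy : same_side (rel2 N lt) zs x y.
  move=> z zs_z; rewrite !rel2_ultrapower !ultra_eq.
  have zs_at_z j : List.In (repr z j) (zs_at j).
    exact: (List.in_map (fun z => repr z j)).
  split; apply: ultra_iff; apply: filterS xyU => j [_ Ex Ey /xyP[_ s _ _]];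
  by rewrite /= Ex Ey; have [] := s _ (zs_at_z j).
have [sxy _] := Nagree x y agree_xy side_xy.
have /sxy : sat phi [tuple of x :: P].
  apply/sat_ultrapower; apply: filterS xyU => j [E Ex _ /xyP[_ _ sx _]] /=.
  by rewrite at_index_cons Ex E.
move/sat_ultrapower/(ultraI xyU) => Ubad.
have /filter_ex[j [[E _ Ey /xyP[_ _ _ nsy]]]] := Ubad.
by rewrite /= at_index_cons Ey E.
Qed.

End Uniform.

(** * Definable relations *)

Section Substitution.
Variable T : Type.

Definition value_at n (e : n.-tuple T) (v : 'I_n + T) : T :=
  match v with inl i => tnth e i | inr c => c end.

Definition substitute n m (v : 'I_n -> 'I_m + T) (e : m.-tuple T) : n.-tuple T :=
  [tuple value_at e (v i) | i < n].

Lemma tnth_substitute n m (v : 'I_n -> 'I_m + T) e i :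
  tnth (substitute v e) i = value_at e (v i).
Proof. by rewrite tnth_map tnth_ord_tuple. Qed.

Lemma behead_cons n x (e : n.-tuple T) : behead_tuple [tuple of x :: e] = e.
Proof. exact/val_inj. Qed.

Lemma thead_cons n x (e : n.-tuple T) : thead [tuple of x :: e] = x.
Proof. by []. Qed.

Lemma tnth_lift0 n x (e : n.-tuple T) i :
  tnth [tuple of x :: e] (lift ord0 i) = tnth e i.
Proof. by rewrite !(tnth_nth x). Qed.

Lemma tnth_behead0 n (e : n.+1.-tuple T) i :
  tnth (behead_tuple e) i = tnth e (lift ord0 i).
Proof. by rewrite (tuple_eta e) tnth_lift0 behead_cons. Qed.

End Substitution.

(** A structure in the sense of van den Dries, with constants:
    the predicates on tuples that are definable with parameters.  Substitution
    of variables and parameters for variables is a single operation, given by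
    a map into variables or constants.  The arguments on
    groups, rings and fields use this interface only. *)
Record definability (T : Type) := Definability {
  dpred : forall n, (n.-tuple T -> Prop) -> Prop;
  dpred_false : forall n, @dpred n (fun _ => False);
  dpred_imp : forall n P Q,
    @dpred n P -> @dpred n Q -> @dpred n (fun e => P e -> Q e);
  dpred_all_cons : forall n P,
    @dpred n.+1 P -> @dpred n (fun e => forall x, P [tuple of x :: e]);
  dpred_substitute : forall n m (v : 'I_n -> 'I_m + T) P,
    @dpred n P -> @dpred m (fun e => P (substitute v e));
  dpred_eq2 : @dpred 2 (fun e => tnth e ord0 = tnth e ord_max) }.
Arguments dpred {T} d {n} P.

Section Definability.
Variables (T : Type) (D : definability T).

(** A function is definable when its graph is; this makes horner evaluation
    and the like definable without being terms of the language. *)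
Definition dfun n (f : n.-tuple T -> T) :=
  dpred D (fun e : n.+1.-tuple T => thead e = f (behead_tuple e)).

Definition dset (A : T -> Prop) := dpred D (fun e : 1.-tuple T => A (thead e)).

Definition drel (F : T -> T -> Prop) :=
  dpred D (fun e : 2.-tuple T => F (thead e) (thead (behead_tuple e))).

Definition dun (f : T -> T) := dfun (fun e : 1.-tuple T => f (thead e)).

Definition dop (f : T -> T -> T) :=
  dfun (fun e : 2.-tuple T => f (thead e) (thead (behead_tuple e))).

Lemma dpred_ext n (P Q : n.-tuple T -> Prop) :
  (forall e, P e <-> Q e) -> dpred D P -> dpred D Q.
Proof. by move=> PQ; rewrite (_ : P = Q) //; apply/funext => e; apply/propext. Qed.

Lemma dpred_rename n m (h : 'I_n -> 'I_m) P :
  dpred D P -> dpred D (fun e => P [tuple tnth e (h i) | i < n]).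
Proof. exact: (dpred_substitute (fun i => inl (h i))). Qed.

(** Binders are turned into coordinates of the tuple: the innermost bound variable
    is [thead e], the next [thead (behead_tuple e)], and so on.  The tactic
    [definability] below proceeds by recursion on the formula in this form. *)
Lemma dpred_all n (P : n.-tuple T -> T -> Prop) :
  dpred D (fun e : n.+1.-tuple T => P (behead_tuple e) (thead e)) ->
  dpred D (fun e => forall x, P e x).
Proof.
move/dpred_all_cons; apply: dpred_ext => e.
by split=> H x; have := H x; rewrite behead_cons.
Qed.

Lemma dpred_not n (P : n.-tuple T -> Prop) :
  dpred D P -> dpred D (fun e => ~ P e).
Proof. by move/dpred_imp; apply; apply: dpred_false. Qed.

Lemma dpred_true n : dpred D (fun _ : n.-tuple T => True).
Proof.
by apply: dpred_ext (dpred_not (dpred_false D n)) => e; split=> // _ [].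
Qed.

Lemma dpred_and n (P Q : n.-tuple T -> Prop) :
  dpred D P -> dpred D Q -> dpred D (fun e => P e /\ Q e).
Proof.
move=> dP dQ; apply: dpred_ext (dpred_not (dpred_imp dP (dpred_not dQ))) => e.
by split=> [/not_implyP[? /contrapT ?]|[? ?] H] //; apply: H.
Qed.

Lemma dpred_or n (P Q : n.-tuple T -> Prop) :
  dpred D P -> dpred D Q -> dpred D (fun e => P e \/ Q e).
Proof.
move=> dP dQ; apply: dpred_ext (dpred_imp (dpred_not dP) dQ) => e.
by split=> [H|[p /(_ p)|]] //; have [|/H] := pselect (P e); [left|right].
Qed.

Lemma dpred_iff n (P Q : n.-tuple T -> Prop) :
  dpred D P -> dpred D Q -> dpred D (fun e => P e <-> Q e).
Proof. by move=> dP dQ; apply: dpred_and; apply: dpred_imp. Qed.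

Lemma dpred_ex n (P : n.-tuple T -> T -> Prop) :
  dpred D (fun e : n.+1.-tuple T => P (behead_tuple e) (thead e)) ->
  dpred D (fun e => exists x, P e x).
Proof.
move=> dP; have := dpred_not (@dpred_all _ (fun e x => ~ P e x) (dpred_not dP)).
by apply: dpred_ext => e; split=> [/existsNP[x /contrapT]|[x Px /(_ x)]//]; exists x.
Qed.

Lemma dfun_behead n (f : n.-tuple T -> T) :
  dfun f -> dfun (fun e : n.+1.-tuple T => f (behead_tuple e)).
Proof.
pose h (i : 'I_n.+1) : 'I_n.+2 :=
  if unlift ord0 i is Some j then lift ord0 (lift ord0 j) else ord0.
move/(dpred_rename h); apply: dpred_ext => e.
(* The value stays at the head; the variable put in is the second one. *)
rewrite (_ : [tuple _ | _ < _] =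
  [tuple of thead e :: behead_tuple (behead_tuple e)]) ?behead_cons //.
apply/eq_from_tnth => i; rewrite tnth_map tnth_ord_tuple /h.
case: unliftP => [j ->|->] //.
by rewrite tnth_lift0 !tnth_behead0.
Qed.

Lemma dfun_thead n : dfun (fun e : n.+1.-tuple T => thead e).
Proof.
pose h (i : 'I_2) : 'I_n.+2 := if i == ord0 then ord0 else lift ord0 ord0.
have := dpred_rename h (dpred_eq2 D); apply: dpred_ext => e.
by rewrite !tnth_map !tnth_ord_tuple /h /= {2}/thead tnth_behead0.
Qed.

Lemma dfun_thead1 n : dfun (fun e : n.+2.-tuple T => thead (behead_tuple e)).
Proof. exact: dfun_behead (@dfun_thead n). Qed.

Lemma dfun_thead2 n :
  dfun (fun e : n.+3.-tuple T => thead (behead_tuple (behead_tuple e))).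
Proof. exact: dfun_behead (@dfun_thead1 n). Qed.

Lemma dfun_thead3 n :
  dfun (fun e : n.+4.-tuple T =>
    thead (behead_tuple (behead_tuple (behead_tuple e)))).
Proof. exact: dfun_behead (@dfun_thead2 n). Qed.

Lemma dfun_const n (c : T) : dfun (fun _ : n.-tuple T => c).
Proof.
pose v (i : 'I_2) : 'I_n.+1 + T := if i == ord0 then inl ord0 else inr c.
have := dpred_substitute v (dpred_eq2 D); apply: dpred_ext => e.
by rewrite !tnth_substitute.
Qed.

(** Substituting a definable function for the first variable: P (f e) holds iff
    P x holds for all x equal to f e. *)
Lemma dpred_cons n (P : n.+1.-tuple T -> Prop) f :
  dpred D P -> dfun f -> dpred D (fun e => P [tuple of f e :: e]).
Proof.
move=> dP df; have := dpred_all_cons (dpred_imp df dP); apply: dpred_ext => e.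
split=> [/(_ (f e))|Pfe x]; first by rewrite behead_cons; apply.
by rewrite thead_cons behead_cons => ->.
Qed.

Lemma dpred_comp1 A : dset A -> forall n (f : n.-tuple T -> T),
  dfun f -> dpred D (fun e => A (f e)).
Proof.
move=> dA n f df.
have dA0 : dpred D (fun e : n.+1.-tuple T => A (thead e)).
  have := dpred_rename (fun _ : 'I_1 => ord0 : 'I_n.+1) dA.
  by apply: dpred_ext => e; rewrite {1}/thead tnth_map.
exact: dpred_cons dA0 df.
Qed.

Lemma drel_tnth F : drel F -> forall n (i j : 'I_n),
  dpred D (fun e => F (tnth e i) (tnth e j)).
Proof.
move=> dF n i j; have := dpred_rename (fun k : 'I_2 => if k == ord0 then i else j) dF.
by apply: dpred_ext => e; rewrite /thead !tnth_behead0 !tnth_map !tnth_ord_tuple.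
Qed.

Lemma dop_tnth h : dop h -> forall n (i j k : 'I_n),
  dpred D (fun e => tnth e i = h (tnth e j) (tnth e k)).
Proof.
move=> dh n i j k; have := dpred_rename (fun l : 'I_3 => if l == ord0 then i else
  if l == lift ord0 ord0 then j else k) dh.
by apply: dpred_ext => e; rewrite /thead !tnth_behead0 !tnth_map !tnth_ord_tuple.
Qed.

Lemma dpred_comp2 F : drel F -> forall n (f g : n.-tuple T -> T),
  dfun f -> dfun g -> dpred D (fun e => F (f e) (g e)).
Proof.
move=> dF n f g df dg.
apply: (@dpred_ext _ (fun e => exists x, x = f e /\ exists y, y = g e /\ F x y)).
  by move=> e; split=> [[_ [-> [_ [->]]]]|] //; exists (f e); split=> //; exists (g e).
apply: dpred_ex; apply: dpred_and df _; apply: dpred_ex.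
apply: dpred_and (dfun_behead dg) _.
apply: dpred_ext (drel_tnth dF (lift ord0 ord0) ord0) => e.
by rewrite /thead tnth_behead0.
Qed.

Lemma dpred_eq n (f g : n.-tuple T -> T) :
  dfun f -> dfun g -> dpred D (fun e => f e = g e).
Proof.
by move=> df dg; have := dpred_cons df dg; apply: dpred_ext => e;
  rewrite behead_cons thead_cons; split.
Qed.

Lemma dfun_comp1 h : dun h -> forall n (f : n.-tuple T -> T),
  dfun f -> dfun (fun e => h (f e)).
Proof.
move=> dh n f df; have dH : drel (fun x y => x = h y) by [].
exact: (dpred_comp2 dH (dfun_thead n) (dfun_behead df)).
Qed.

Lemma dfun_comp2 h : dop h -> forall n (f g : n.-tuple T -> T),
  dfun f -> dfun g -> dfun (fun e => h (f e) (g e)).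
Proof.
move=> dh n f g df dg; pose b := @behead_tuple n.+1 T.
apply: (@dpred_ext _ (fun e => exists x, x = f (b e) /\ exists y, y = g (b e) /\
    thead e = h x y)).
  move=> e; split=> [[_ [-> [_ [->]]]]|] //.
  by exists (f (b e)); split=> //; exists (g (b e)).
apply: dpred_ex; apply: dpred_and (dfun_behead df) _; apply: dpred_ex.
apply: dpred_and (dfun_behead (dfun_behead dg)) _.
apply: dpred_ext (dop_tnth dh (lift ord0 (lift ord0 ord0)) (lift ord0 ord0) ord0) => e.
by rewrite /thead !tnth_behead0.
Qed.

End Definability.

Ltac definability := repeat match goal with
  | |- forall _, _ => move=> ?
  | |- dpred _ (fun _ => ~ _) => apply: dpred_not
  | |- dpred _ (fun _ => _ /\ _) => apply: dpred_and
  | |- dpred _ (fun _ => _ \/ _) => apply: dpred_or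
  | |- dpred _ (fun _ => _ <-> _) => apply: dpred_iff
  | |- dpred _ (fun _ => exists _, _) => apply: dpred_ex
  | |- dpred _ (fun _ => _ -> _) => apply: dpred_imp
  | |- dpred _ (fun _ => forall _, _) => apply: dpred_all
  | |- dpred _ (fun _ => _ = _) => apply: dpred_eq
  | H : dset _ ?A |- dpred _ (fun _ => ?A _) => apply: (dpred_comp1 H)
  | H : drel _ ?A |- dpred _ (fun _ => ?A _ _) => apply: (dpred_comp2 H)
  | |- dfun _ (fun _ => ?c) => exact: dfun_const
  | |- dfun _ (@thead _ _) => exact: dfun_thead
  | |- dfun _ (fun _ => thead _) =>
      first [exact: dfun_thead | exact: dfun_thead1 | exact: dfun_thead2
            | exact: dfun_thead3]
  | H : dun _ ?h |- dfun _ (fun _ => ?h _) => apply: (dfun_comp1 H)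
  | H : dop _ ?h |- dfun _ (fun _ => ?h _ _) => apply: (dfun_comp2 H)
  | |- dset _ _ => rewrite /dset
  | |- drel _ _ => rewrite /drel
  end.

(** What quasi-o-minimality provides within the structure itself: a family
    of sets is governed by one finite colouring with definable classes, up to
    at most m cut points for each member. *)
Definition tame (T : Type) (D : definability T) (lt : T -> T -> Prop) : Prop :=
  forall F, drel D F -> exists (C : finType) (tau : T -> C) (m : nat),
    (forall c, dset D (fun x => tau x = c)) /\
    forall a, exists2 zs, (size zs <= m)%N & forall x y,
      tau x = tau y -> same_side lt zs x y -> F x a -> F y a.

(** * The definable relations of a structure *)

Section Renaming.
Variable L : language.

Fixpoint rename_term n m (h : 'I_n -> 'I_m) (t : term L n) : term L m :=
  match t with
  | Var i => Var L (h i)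
  | App k f ts => App f (fun i => rename_term h (ts i))
  end.

Definition lift_rename n m (h : 'I_n -> 'I_m) (i : 'I_n.+1) : 'I_m.+1 :=
  if unlift ord0 i is Some j then lift ord0 (h j) else ord0.

Fixpoint rename n (phi : formula L n) : forall m, ('I_n -> 'I_m) -> formula L m :=
  match phi with
  | Fal _ => fun m _ => Fal L m
  | Eq _ t u => fun m h => Eq (rename_term h t) (rename_term h u)
  | Rel _ k r ts => fun m h => Rel r (fun i : 'I_k => rename_term h (ts i))
  | Imp _ phi psi => fun m h => Imp (rename phi h) (rename psi h)
  | All _ phi => fun m h => All (rename phi (lift_rename h))
  end.

Variable M : structure L.

Lemma eval_rename n m (h : 'I_n -> 'I_m) (t : term L n) (e : m.-tuple M) :
  eval e (rename_term h t) = eval [tuple tnth e (h i) | i < n] t.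
Proof.
elim: t => [i|k f ts IH] /=; first by rewrite tnth_map tnth_ord_tuple.
congr fun_interp; apply/eq_from_tnth => i.
by rewrite !tnth_map !tnth_ord_tuple IH.
Qed.

Lemma sat_rename n (phi : formula L n) m (h : 'I_n -> 'I_m) (e : m.-tuple M) :
  sat (rename phi h) e <-> sat phi [tuple tnth e (h i) | i < n].
Proof.
elim: phi m h e => {n} [n|n t u|n k r ts|n phi IH psi IH'|n phi IH] m h e //=.
- by rewrite !eval_rename.
- rewrite (_ : [tuple eval e (rename_term h (ts i)) | i < k] =
    [tuple eval [tuple tnth e (h j) | j < n] (ts i) | i < k]) //.
  by apply/eq_from_tnth => i; rewrite !tnth_map !tnth_ord_tuple eval_rename.
- by rewrite IH IH'.
- have E x : [tuple tnth [tuple of x :: e] (lift_rename h i) | i < n.+1] =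
      [tuple of x :: [tuple tnth e (h i) | i < n]].
    apply/eq_from_tnth => i; rewrite tnth_map tnth_ord_tuple /lift_rename.
    case: unliftP => [j ->|-> //].
    by rewrite !tnth_lift0 tnth_map tnth_ord_tuple.
  by split=> H x; have := H x; rewrite IH E.
Qed.

End Renaming.

Section StructureDefinability.
Variables (L : language) (M : structure L) (x0 : M).

(** Formula, variables and parameters are kept apart from the tuple by the map
    [v], so renaming and fixing parameters only change [v]. *)
Definition sat_pred n (P : n.-tuple M -> Prop) := exists N (phi : formula L N)
  (v : 'I_N -> 'I_n + M), forall e, P e <-> sat phi (substitute v e).

Lemma sat_pred_cons n (P : n.+1.-tuple M -> Prop) : sat_pred P ->
  exists N (phi : formula L N.+1) (v : 'I_N -> 'I_n + M), forall x (e : n.-tuple M),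
    P [tuple of x :: e] <-> sat phi [tuple of x :: substitute v e].
Proof.
case=> N [phi [v Pphi]].
(* [h] merges the variables of [phi] that stand for the first
   coordinate into variable 0; [x0] is a value of [w] never looked up. *)
pose h i : 'I_N.+1 := if v i is inl j then
  if unlift ord0 j is Some _ then lift ord0 i else ord0 else lift ord0 i.
pose w i : 'I_n + M := match v i with
  | inl j => if unlift ord0 j is Some k then inl k else inr x0 | inr c => inr c end.
exists N, (rename phi h), w => x e; rewrite Pphi sat_rename.
rewrite (_ : substitute v _ =
  [tuple tnth [tuple of x :: substitute w e] (h i) | i < N]) //.
apply/eq_from_tnth => i; rewrite tnth_substitute tnth_map tnth_ord_tuple /h.
case vi : (v i) => [j|c] /=; last by rewrite tnth_lift0 tnth_substitute /w vi.
case: unliftP => [k jk|-> //].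
by rewrite tnth_lift0 tnth_substitute /w vi jk liftK tnth_lift0.
Qed.

Lemma sat_pred_false n : sat_pred (fun _ : n.-tuple M => False).
Proof. by exists 0%N, (Fal L 0), (fun _ => inr x0). Qed.

Lemma sat_pred_imp n (P Q : n.-tuple M -> Prop) :
  sat_pred P -> sat_pred Q -> sat_pred (fun e => P e -> Q e).
Proof.
case=> N [phi [v Pphi]] [N' [psi [v' Qpsi]]].
pose w i := match fintype.split i with inl j => v j | inr j => v' j end.
exists (N + N')%N, (Imp (rename phi (@lshift N N')) (rename psi (@rshift N N'))), w.
move=> e; rewrite /= !sat_rename Pphi Qpsi.
have El : substitute v e = [tuple tnth (substitute w e) (lshift N' i) | i < N].
  apply/eq_from_tnth => i; rewrite tnth_substitute tnth_map tnth_ord_tuple.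
  rewrite tnth_substitute /w.
  by rewrite (unsplitK (inl i)).
have Er : substitute v' e = [tuple tnth (substitute w e) (rshift N i) | i < N'].
  apply/eq_from_tnth => i; rewrite tnth_substitute tnth_map tnth_ord_tuple.
  rewrite tnth_substitute /w.
  by rewrite (unsplitK (inr i)).
by rewrite El Er.
Qed.

Lemma sat_pred_all n (P : n.+1.-tuple M -> Prop) :
  sat_pred P -> sat_pred (fun e => forall x, P [tuple of x :: e]).
Proof.
case/sat_pred_cons=> N [phi [v Pphi]]; exists N, (All phi), v => e /=.
by split=> H x; apply/Pphi.
Qed.

Lemma sat_pred_substitute n m (v : 'I_n -> 'I_m + M) P :
  sat_pred P -> sat_pred (fun e => P (substitute v e)).
Proof.
case=> N [phi [w Pphi]].
pose u i := match w i with inl j => v j | inr c => inr c end.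
exists N, phi, u => e; rewrite Pphi.
suff -> : substitute w (substitute v e) = substitute u e by [].
apply/eq_from_tnth => i; rewrite !tnth_substitute /u.
by case: (w i) => //= j; rewrite tnth_substitute.
Qed.

Lemma sat_pred_formula n (phi : formula L n) : sat_pred (sat phi).
Proof.
exists n, phi, inl => e; suff -> : substitute inl e = e by [].
by apply/eq_from_tnth => i; rewrite tnth_substitute.
Qed.

Definition structure_definability : definability M :=
  Definability sat_pred_false sat_pred_imp sat_pred_all sat_pred_substitute
    (sat_pred_formula (Eq (Var L ord0) (Var L ord_max))).

Let D := structure_definability.

Lemma dpred_formula n (phi : formula L n) :
  dpred D (sat phi : n.-tuple M -> Prop).
Proof. exact: sat_pred_formula. Qed.

Lemma definable_dset A : definable M A <-> dset D A.
Proof.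
split=> [[n [phi [p ->]]]|].
  pose v (i : 'I_n.+1) : 'I_1 + M :=
    if unlift ord0 i is Some j then inr (tnth p j) else inl ord0.
  apply: dpred_ext (dpred_substitute v (dpred_formula phi)) => e.
  rewrite (_ : substitute v e = [tuple of thead e :: p]) //.
  apply/eq_from_tnth => i; rewrite tnth_substitute /v.
  by case: unliftP => [j ->|->] //; rewrite tnth_lift0.
case/sat_pred_cons => N [phi [v Aphi]].
exists N, phi, (substitute v [tuple]); rewrite predeqE => x.
exact: (Aphi x [tuple]).
Qed.

Lemma drel_rel2 (r : relations L 2) : drel D (rel2 M r).
Proof.
apply: dpred_ext (dpred_formula (Rel r (@Var L 2))) => e /=.
rewrite /rel2 (_ : [tuple eval e (Var L i) | i < 2] =
  [tuple thead e; thead (behead_tuple e)]) //.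
apply/eq_from_tnth => i; rewrite tnth_map tnth_ord_tuple /=.
case: (unliftP ord0 i) => [j ->|->] //.
by rewrite tnth_lift0 -tnth_behead0 (ord1 j).
Qed.

Lemma dop_fun2 (f : functions L 2) : dop D (fun2 M f).
Proof.
pose phi := Eq (Var L (ord0 : 'I_3)) (App f (fun i : 'I_2 => Var L (lift ord0 i))).
apply: dpred_ext (dpred_formula phi) => e /=.
rewrite /fun2 (_ : [tuple eval e (Var L (lift ord0 i)) | i < 2] =
  [tuple thead (behead_tuple e); thead (behead_tuple (behead_tuple e))]) //.
apply/eq_from_tnth => i; rewrite tnth_map tnth_ord_tuple /= -tnth_behead0.
case: (unliftP ord0 i) => [j ->|->] //.
by rewrite tnth_lift0 -tnth_behead0 (ord1 j).
Qed.

Lemma quasi_o_minimal_tame (lt : relations L 2) :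
  quasi_o_minimal lt M -> tame D (rel2 M lt).
Proof.
move=> qM F dF; have [N [phi [v Fphi]]] := sat_pred_cons dF.
have [ths [m unif]] := uniform_finiteness qM phi.
pose colour (s : seq (formula L 1)) (x : M) := [seq `[<sat th [tuple x]>] | th <- s].
have size_colour x : size (colour ths x) == size ths by rewrite size_map.
exists ((size ths).-tuple bool), (fun x => Tuple (size_colour x)), m; split.
  move=> c; suff: dset D (fun x => colour ths x = c).
    by move=> dcol; apply: dpred_ext dcol => e; split=> [H|<- //]; apply/val_inj.
  elim: (ths) (val c) => [|th s IH] [|b bs] /=.
  - by apply: dpred_ext (dpred_true D 1) => e; split.
  - by apply: dpred_ext (dpred_false D 1) => e; split.
  - by apply: dpred_ext (dpred_false D 1) => e; split.
  have dth : dset D (fun x => sat th [tuple x]).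
    apply: dpred_ext (dpred_formula th) => e.
    by rewrite (_ : e = [tuple thead e]) //; apply/eq_from_tnth => i; rewrite (ord1 i).
  apply: (@dpred_ext _ D _ (fun e => (sat th [tuple thead e] <-> b) /\
      colour s (thead e) = bs)).
    move=> e; split=> [[/asbool_equiv_eq Eb <-]|[<- <-]]; last first.
      by split=> //; rewrite asboolE.
    by rewrite Eb asboolb.
  apply: dpred_and (IH bs); apply: dpred_iff => //.
  case: b; first by apply: dpred_ext (dpred_true D 1) => e; split.
  by apply: dpred_ext (dpred_false D 1) => e; split.
move=> a; have [zs szs H] := unif (substitute v [tuple a]).
exists zs => // x y /(congr1 val)/List.map_ext_in_iff/= E side.
have FE z : F z a <-> sat phi [tuple of z :: substitute v [tuple a]].
  by rewrite -Fphi.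
rewrite !FE; apply: H => // th ths_th.
exact: (asbool_eq_equiv (E th ths_th)).
Qed.

End StructureDefinability.

(** * Tame ordered groups *)

Lemma pigeonhole_nat (S : finType) (g : nat -> S) :
  exists i j, [/\ (i < j)%N, (j <= #|S|)%N & g i = g j].
Proof.
apply: contrapT => H.
have inj : injective (fun i : 'I_#|S|.+1 => g i).
  move=> i j E; apply/val_inj => /=.
  by case: (ltngtP i j) => // ij; case: H;
    [exists i, j | exists j, i]; split=> //; rewrite -ltnS.
have := leq_card _ inj; by rewrite card_ord ltnn.
Qed.

Definition definably_complete (T : Type) (D : definability T) (lt : T -> T -> Prop) :=
  forall K : T -> Prop, dset D K -> (exists x, K x) -> (exists x, ~ K x) ->
    (forall x y, K y -> lt x y -> K x) ->
    exists s, (forall x, lt x s -> K x) /\ (forall x, lt s x -> ~ K x).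

Definition eventually_constant (T : Type) (D : definability T) (lt : T -> T -> Prop) :=
  forall A : T -> Prop, dset D A ->
    exists c, forall x y, lt c x -> lt c y -> A x -> A y.

Section OrderedGroup.
Local Open Scope ring_scope.
Import GRing.Theory.
Variables (V : zmodType) (lt : V -> V -> Prop).
Local Notation "x < y" := (lt x y) : ring_scope.
Hypothesis lt_linear : linear_order lt.
Hypothesis ltD2 : forall x y z, x < y -> x + z < y + z.

Lemma ltxx x : ~ x < x. Proof. by case: lt_linear. Qed.

Lemma lt_tr y x z : x < y -> y < z -> x < z.
Proof. by case: lt_linear => _ tr _; apply: tr. Qed.

Lemma lt_asym x y : x < y -> ~ y < x.
Proof. by move=> xy /(lt_tr xy)/ltxx. Qed.

Lemma lt_tot x y : [\/ x < y, x = y | y < x].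
Proof. by case: lt_linear. Qed.

Lemma nlt_lt_tr y x z : ~ y < x -> y < z -> x < z.
Proof. by case: (lt_tot x y) => [xy|->|] // _; apply: lt_tr. Qed.

Lemma lt_nlt_tr y x z : x < y -> ~ z < y -> x < z.
Proof. by move=> xy; case: (lt_tot y z) => [yz|<-|] // _; apply: lt_tr yz. Qed.

Lemma ltDr z x y : x + z < y + z <-> x < y.
Proof. by split=> [/(@ltD2 _ _ (- z))|/ltD2//]; rewrite !addrK. Qed.

Lemma ltDl z x y : z + x < z + y <-> x < y.
Proof. by rewrite ![z + _]addrC ltDr. Qed.

Lemma sub_pos x y : 0 < y - x <-> x < y.
Proof. by rewrite -(ltDr x) add0r subrK. Qed.

Lemma opp_pos x : 0 < - x <-> x < 0.
Proof. by rewrite -(sub_pos x 0) sub0r. Qed.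

Lemma ltDpos x h : 0 < h -> x < x + h.
Proof. by move/(ltDl x 0); rewrite addr0. Qed.

Lemma ltDneg x h : h < 0 -> x + h < x.
Proof. by move/(ltDl x); rewrite addr0. Qed.

Lemma add_pos x y : 0 < x -> 0 < y -> 0 < x + y.
Proof. by move=> x0 y0; apply: lt_tr x0 _; apply: ltDpos. Qed.

Lemma mulrn_pos x n : 0 < x -> (0 < n)%N -> 0 < x *+ n.
Proof.
move=> x0; case: n => // n _; elim: n => [|n IH]; first by rewrite mulr1n.
by rewrite mulrS; apply: add_pos.
Qed.

Lemma mulrn_inj n (x y : V) : (0 < n)%N -> x *+ n = y *+ n -> x = y.
Proof.
move=> n0 E; apply/eqP; rewrite -subr_eq0; apply/eqP.
have {}E : (x - y) *+ n = 0 by rewrite mulrnBl E subrr.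
have [lt0|//|gt0] := lt_tot (x - y) 0; exfalso.
  have := mulrn_pos (n := n) (proj2 (opp_pos _) lt0) n0.
  by rewrite mulNrn E oppr0 => /ltxx.
by have := mulrn_pos gt0 n0; rewrite E => /ltxx.
Qed.

Lemma upper_bound2 (C : V -> Prop) a b : C a -> C b ->
  exists c, [/\ C c, ~ c < a & ~ c < b].
Proof.
move=> Ca Cb; have [ab|ab|ba] := lt_tot a b.
- by exists b; split; [|apply: lt_asym|apply: ltxx].
- by exists b; rewrite ab; split=> //; apply: ltxx.
- by exists a; split; [|apply: ltxx|apply: lt_asym].
Qed.

Lemma list_upper_bound (C : V -> Prop) u zs : C u ->
  exists u', [/\ C u', ~ u' < u & forall z, List.In z zs -> C z -> ~ u' < z].
Proof.
move=> Cu; elim: zs => [|z zs [w [Cw wu H]]].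
  by exists u; split=> //; apply: ltxx.
have [Cz|nCz] := pselect (C z); last first.
  by exists w; split=> // z' [<- //|]; apply: H.
have [c [Cc cw cz]] := upper_bound2 Cw Cz.
exists c; split=> // [cu|z' [<- _ //|z'zs Cz' cz']].
  by apply: wu; apply: nlt_lt_tr cu.
by apply: (H _ z'zs Cz'); apply: nlt_lt_tr cz'.
Qed.

End OrderedGroup.

Section TameGroup.
Local Open Scope ring_scope.
Import GRing.Theory.
Variables (V : zmodType) (lt : V -> V -> Prop) (D : definability V).
Local Notation "x < y" := (lt x y) : ring_scope.
Hypothesis lt_linear : linear_order lt.
Hypothesis ltD2 : forall x y z, x < y -> x + z < y + z.
Hypothesis dlt : drel D lt.
Hypothesis dadd : dop D (fun x y => x + y).
Hypothesis D_tame : tame D lt.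

Definition moves (K : V -> Prop) h := exists k, K k /\ ~ K (k + h).

(** Minimal counterexample: an interval (u, v) whose length moves K, with as few
    colours as possible.  A translate K' of K has its cut between u and
    v; shrinking to (u', v') removes the cut points of K', so the colour
    decides membership in K' there.  Both sides of the cut are inhabited next
    to it, hence each side misses a colour of the other.  Split the
    length of (u', v') into two that move K: one of the two parts lies entirely
    on one side of the cut and has fewer colours. *)
Lemma no_gap (K : V -> Prop) : dset D K ->
  (forall x y, K y -> x < y -> K x) ->
  (exists h, moves K h) ->
  (forall x, K x -> exists y, x < y /\ K y) ->
  (forall x, ~ K x -> exists y, y < x /\ ~ K y) ->
  (forall h, moves K h -> exists h1, moves K h1 /\ moves K (h - h1)) ->
  False.
Proof.
move=> dK Kdown [h0 mh0] Knomax Knomin split_moves.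
have dF : drel D (fun x a => exists z, z + a = x /\ K z) by definability.
have [C [tau [m [_ tauP]]]] := D_tame dF.
pose cols u v : {set C} := [set c | `[< exists y, [/\ u < y, y < v & tau y = c] >]].
suff main n u v : (#|cols u v| < n)%N -> moves K (v - u) -> False.
  by apply: (main #|cols 0 h0|.+1 0 h0) => //; rewrite subr0.
elim: n u v => // n IH u v cuv [k [Kk nKk]].
pose a := u - k; pose K' x := K (x - a).
have K'u : K' u by rewrite /K' /a opprB addrC subrK.
have nK'v : ~ K' v by rewrite /K' /a opprB addrCA.
have K'down x y : K' y -> x < y -> K' x.
  by move=> Ky xy; apply: Kdown Ky _; apply: ltD2.
have [zs _ zsP] := tauP a.
have [u' [K'u' uu' zu']] := list_upper_bound lt_linear zs K'u.
have lt_rev : linear_order (fun x y => y < x).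
  case: (lt_linear) => irr tr tot; split=> // [x y z xy yz|x y]; first exact: tr xy.
  by case: (tot x y); [constructor 3|constructor 2|constructor 1].
have [v' [nK'v' vv' zv']] :=
  list_upper_bound (C := fun x => ~ K' x) lt_rev zs nK'v.
have mono x y : u' < x -> y < v' -> x < v' -> u' < y -> tau x = tau y -> K' x -> K' y.
  move=> ux yv xv uy txy K'x.
  have /zsP : same_side lt zs x y.
    move=> z zs_z; have [K'z|nK'z] := pselect (K' z).
      have zx := nlt_lt_tr lt_linear (zu' z zs_z K'z) ux.
      have zy := nlt_lt_tr lt_linear (zu' z zs_z K'z) uy.
      have out w : z < w -> (w < z <-> False) /\ (w = z <-> False).
        move=> zw; split; split=> // E; first exact: (lt_asym lt_linear zw).
        by rewrite E in zw; apply: (ltxx lt_linear zw).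
      by rewrite !(proj1 (out _ _)) // !(proj2 (out _ _)).
    have zx := lt_nlt_tr lt_linear xv (zv' z zs_z nK'z).
    have zy := lt_nlt_tr lt_linear yv (zv' z zs_z nK'z).
    have neq w : w < z -> (w = z <-> False).
      by move=> wz; split=> // E; rewrite E in wz; apply: (ltxx lt_linear wz).
    by rewrite !neq.
  move=> /(_ txy)[|z [<- Kz]]; first by exists (x - a); rewrite subrK.
  by rewrite /K' addrK.
have sep x y : K' x -> ~ K' y -> x < y.
  move=> Kx nKy; have [//|E|yx] := lt_tot lt_linear x y; first by rewrite E in Kx.
  by case: nKy; apply: K'down Kx yx.
have card_lt (w w' : V) y : ~ w < u -> ~ v < w' -> u < y -> y < v ->
    (forall y', w < y' -> y' < w' -> tau y' <> tau y) -> (#|cols w w'| < n)%N.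
  move=> uw wv uy yv ny; rewrite -ltnS; apply: leq_trans cuv.
  rewrite ltnS; apply: proper_card; apply/fintype.properP; split.
    apply/fintype.subsetP => c; rewrite !inE => -[x [wx xw' <-]]; exists x; split=> //.
      exact: (nlt_lt_tr lt_linear uw wx).
    exact: (lt_nlt_tr lt_linear xw' wv).
  exists (tau y); first by rewrite !inE; exists y.
  by rewrite inE; apply/asboolPn => -[y' [wy yw]]; apply: ny.
have [h1 [mh1 mh2]] : exists h1, moves K h1 /\ moves K (v' - u' - h1).
  apply: split_moves; exists (u' - a); split=> // H; apply: nK'v'.
  by move: H; rewrite addrC subrKA.
pose w := u' + h1.
have mw1 : moves K (w - u') by rewrite /w addrC addKr.
have mw2 : moves K (v' - w) by rewrite /w opprD addrA.
have [K'w|nK'w] := pselect (K' w).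
- have [x [xv' nK'x]] : exists x, x < v' /\ ~ K' x.
    have [x [xv nKx]] := Knomin _ nK'v'; exists (x + a).
    by rewrite /K' addrK -(ltDr ltD2 (- a)) addrK.
  have u'x := sep _ _ K'u' nK'x.
  apply: (IH u' w) mw1; apply: (card_lt _ _ x uu').
  + by move=> vw; apply: nK'v; apply: K'down K'w vw.
  + exact: (nlt_lt_tr lt_linear uu' u'x).
  + exact: (lt_nlt_tr lt_linear xv' vv').
  + move=> y u'y yw E; apply: nK'x; have K'y := K'down _ _ K'w yw.
    exact: (mono y x u'y xv' (sep _ _ K'y nK'v') u'x E K'y).
- have [x [u'x K'x]] : exists x, u' < x /\ K' x.
    have [x [ux Kx]] := Knomax _ K'u'; exists (x + a).
    by rewrite /K' addrK -(ltDr ltD2 (- a)) addrK.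
  have xv' := sep _ _ K'x nK'v'.
  apply: (IH w v') mw2; apply: (card_lt _ _ x _ vv').
  + by move=> wu; apply: nK'w; apply: K'down K'u wu.
  + exact: (nlt_lt_tr lt_linear uu' u'x).
  + exact: (lt_nlt_tr lt_linear xv' vv').
  + move=> y wy yv' E; have u'y := lt_tr lt_linear (sep _ _ K'u' nK'w) wy.
    apply: nK'w; apply: K'down wy; exact: (mono x y u'x yv' xv' u'y (esym E) K'x).
Qed.

(** Near the end of C0 the cut points play no role, so the germ of F(a) there is
    given by the set of colours that F(a) meets, one of finitely many. *)
Lemma finitely_many_germs F (C0 : V -> Prop) : drel D F ->
  (exists x, C0 x) -> (forall x y, C0 y -> x < y -> C0 x) ->
  exists (S : finType) (t : V -> S), forall a b, t a = t b ->
    exists2 c, C0 c & forall x, C0 x -> c < x -> F x a <-> F x b.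
Proof.
move=> dF [x0 C0x0] Cdown.
have [C [tau [m [_ tauP]]]] := D_tame dF.
have /choice[c cP] a : exists c, C0 c /\ forall x y, C0 x -> C0 y -> c < x -> c < y ->
    tau x = tau y -> F x a -> F y a.
  have [zs _ zsP] := tauP a; have [c [Cc _ cz]] := list_upper_bound lt_linear zs C0x0.
  exists c; split=> // x y Cx Cy cx cy E; apply: (zsP x y E) => z zs_z {E}.
  have [Cz|nCz] := pselect (C0 z).
    have zc := cz z zs_z Cz.
    have out w : c < w -> (w < z <-> False) /\ (w = z <-> False).
      move=> /(nlt_lt_tr lt_linear zc) zw; split; split=> // E.
        exact: (lt_asym lt_linear zw).
      by rewrite E in zw; apply: (ltxx lt_linear zw).
    by rewrite !(proj1 (out _ _)) // !(proj2 (out _ _)).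
  have out w : C0 w -> (w < z <-> True) /\ (w = z <-> False).
    move=> Cw; split; split=> // E; last by rewrite E in Cw.
    have [//|E'|zw] := lt_tot lt_linear w z; first by rewrite E' in Cw.
    by case: nCz; apply: Cdown zw.
  by rewrite !(proj1 (out _ _)) // !(proj2 (out _ _)).
pose t a : {ffun C -> bool} :=
  [ffun k => `[< exists x, [/\ C0 x, c a < x, tau x = k & F x a] >]].
have half a b d : ~ d < c a -> ~ d < c b -> t a = t b ->
    forall x, C0 x -> d < x -> F x a -> F x b.
  move=> da db tab x Cx dx Fxa.
  have : t a (tau x).
    rewrite ffunE; apply/asboolP; exists x; split=> //.
    exact: (nlt_lt_tr lt_linear da dx).
  rewrite tab ffunE => /asboolP[y [Cy cy E Fyb]].
  have [_ cb] := cP b; apply: (cb y x) => //; exact: (nlt_lt_tr lt_linear db dx).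
exists {ffun C -> bool}, t => a b tab.
have [d [Cd da db]] := upper_bound2 lt_linear (proj1 (cP a)) (proj1 (cP b)).
exists d => // x Cx dx; split; first exact: (half a b d).
by apply: (half b a d).
Qed.

Definition divisible := forall n (x : V), (0 < n)%N -> exists y, x = y *+ n.

Hypothesis V_nontrivial : exists x : V, x <> 0.

Lemma exists_pos : exists x, 0 < x.
Proof.
have [x x0] := V_nontrivial; have [ltx|//|gtx] := lt_tot lt_linear x 0.
  by exists (- x); apply/(opp_pos ltD2).
by exists x.
Qed.

Section Divisible.
Hypothesis V_divisible : divisible.

(** A cut without supremum is a gap, and a length [h] that moves K splits into
    two halves that do: if h/2 did not, neither would h. *)
Lemma divisible_complete : definably_complete D lt.
Proof.
move=> K dK [x Kx] [y nKy] Kdown; apply: contrapT => nosup.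
apply: (no_gap dK Kdown).
- by exists (y - x), x; rewrite addrC subrK.
- move=> a Ka; apply: contrapT => H; apply: nosup; exists a; split=> b.
    exact: Kdown.
  by move=> ab Kb; apply: H; exists b.
- move=> a nKa; apply: contrapT => H; apply: nosup; exists a; split=> b.
    by move=> ba; apply: contrapT => nKb; apply: H; exists b.
  by move=> ab Kb; apply/nKa/(Kdown _ _ Kb).
- move=> h [k [Kk nKkh]]; have [z hz] := V_divisible h (isT : (0 < 2)%N).
  exists z; have -> : h - z = z by rewrite hz mulr2n addrK.
  suff: moves K z by [].
  have [Kz|nKz] := pselect (K (k + z)); last by exists k.
  by exists (k + z); split=> //; rewrite -addrA -mulr2n -hz.
Qed.

(** Among the translates of A by the multiples of r/N!, with N the number of
    germs, two with index at most N share their germ at infinity.  Their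
    difference d divides r, and the germ of A is invariant under d, hence
    under r. *)
Lemma translate_at_infinity A : dset D A -> forall r,
  exists c, forall x, c < x -> A x <-> A (x + r).
Proof.
move=> dA r.
have dF : drel D (fun x a => A (x + a)) by definability.
have [||S [t tP]] := finitely_many_germs (C0 := fun _ => True) dF;
  [by exists 0|by []|].
have [y ry] := V_divisible r (fact_gt0 #|S|).
have [i [j [ij jS E]]] := pigeonhole_nat (fun i => t (y *+ i)).
have [c _ cP] := tP _ _ E.
pose d := y *+ (j - i).
have d1 x : c + y *+ i < x -> A x <-> A (x + d).
  move=> cx; have := cP (x - y *+ i) I.
  rewrite subrK addrAC -addrA -mulrnBr 1?ltnW //; apply.
  by rewrite -(ltDr ltD2 (y *+ i)) subrK.
have [q rq] : exists q, r = d *+ q.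
  exists ((#|S|)`! %/ (j - i))%N; rewrite ry -mulrnA mulnC divnK //.
  apply: dvdn_fact; rewrite subn_gt0 ij /=; exact: leq_trans (leq_subr _ _) jS.
(* d may be negative, so the bound has to be pushed at each step. *)
rewrite rq; elim: q {r ry rq} => [|q [c' IH]]; first by exists 0 => x _; rewrite addr0.
have [e [_ e1 e2]] := upper_bound2 lt_linear (C := fun _ => True) (a := c')
   (b := c + y *+ i - d *+ q) I I.
exists e => x ex; rewrite IH; last exact: (nlt_lt_tr lt_linear e1 ex).
rewrite mulrSr addrA; apply: d1; rewrite -(ltDr ltD2 (- (d *+ q))) addrK.
exact: (nlt_lt_tr lt_linear e2 ex).
Qed.

Definition subgroup (H : V -> Prop) :=
  (forall x y, H x -> H y -> H (x + y)) /\ (forall x, H x -> H (- x)).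

(** A nonzero definable subgroup H is cofinal, since otherwise the supremum s of
    its hull would satisfy s + h <= s for a positive h in H.  The germ of H at
    infinity is invariant under every r, so r is a difference of two
    elements of H. *)
Lemma definable_subgroup_trivial H : dset D H -> subgroup H ->
  (exists2 h, H h & h <> 0) -> forall x, H x.
Proof.
move=> dH [HD HN] [h Hh h0].
have [p Hp p0] : exists2 p, H p & 0 < p.
  have [ltx|//|gtx] := lt_tot lt_linear h 0; last by exists h.
  by exists (- h); [exact: HN | apply/(opp_pos ltD2)].
pose K y := exists h, H h /\ y < h.
have K_all y : K y.
  apply: contrapT => nKy.
  have dK : dset D K by rewrite /K; definability.
  have [||x z [g [Hg zg]] xz|s [s1 s2]] := divisible_complete dK.
  - by exists 0, p.
  - by exists y.
  - by exists g; split=> //; exact: (lt_tr lt_linear xz zg).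
  have [g [Hg sg]] : K (s - p).
    by apply: s1; rewrite -(ltDr ltD2 p) subrK; exact: (ltDpos ltD2).
  apply: (s2 (g + p)); first by rewrite -(ltDr ltD2 (- p)) addrK.
  exists (g + p + p); split; first by apply: (HD _ _ (HD _ _ Hg Hp) Hp).
  exact: (ltDpos ltD2).
move=> r; have [c cP] := translate_at_infinity dH r.
have [g [Hg cg]] := K_all c; have /(cP g cg) Hgr := Hg.
by rewrite -(addKr g r); apply: HD Hgr; apply: HN.
Qed.

(** For fixed c, the h under which A is invariant beyond c form a definable
    subgroup.  For some c it contains a given r > 0, so it is everything. *)
Lemma divisible_eventually_constant : eventually_constant D lt.
Proof.
move=> A dA; have [r r0] := exists_pos.
have [c cP] := translate_at_infinity dA r.
pose S h := forall x, c < x -> c < x + h -> A x <-> A (x + h).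
have dS : dset D S by rewrite /S; definability.
have subS : subgroup S.
  split=> [h h' Sh Sh' x cx|h Sh x cx].
    rewrite addrA => cxhh'.
    have [cxh|ncxh] := pselect (c < x + h).
      by rewrite (Sh x cx cxh); apply: Sh'.
    have [cxh'|ncxh'] := pselect (c < x + h').
      by rewrite (Sh' x cx cxh') [x + h + h']addrAC; apply: Sh; rewrite // addrAC.
    exfalso; apply: ncxh; apply: (lt_tr lt_linear cxhh').
    rewrite -{2}[x + h]addr0 (ltDl ltD2) -(ltDl ltD2 x) addr0.
    exact: (nlt_lt_tr lt_linear ncxh' cx).
  by move=> cxh; symmetry; have := Sh (x - h) cxh; rewrite subrK; apply.
have S_all : forall h, S h.
  apply: (definable_subgroup_trivial dS subS); exists r.
    by move=> x cx _; apply: cP.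
  by move=> E; rewrite E in r0; apply: (ltxx lt_linear r0).
by exists c => x y cx cy; have := S_all (y - x) x cx; rewrite addrC subrK => -[].
Qed.

End Divisible.

End TameGroup.

(** * Tame ordered rings *)

Section TameRing.
Local Open Scope ring_scope.
Import GRing.Theory.
Variables (V : zmodType) (lt : V -> V -> Prop) (D : definability V).
Local Notation "x < y" := (lt x y) : ring_scope.
Hypothesis lt_linear : linear_order lt.
Hypothesis ltD2 : forall x y z, x < y -> x + z < y + z.
Hypothesis dlt : drel D lt.
Hypothesis dadd : dop D (fun x y => x + y).
Hypothesis D_tame : tame D lt.
Variable mul : V -> V -> V.
Local Notation "x * y" := (mul x y) : ring_scope.
Hypothesis dmul : dop D mul.
Hypothesis mulDl : left_distributive mul (fun x y => x + y).
Hypothesis mulDr : right_distributive mul (fun x y => x + y).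
Hypothesis mul_ge0 : forall x y, ~ x < 0 -> ~ y < 0 -> ~ x * y < 0.
Hypothesis mul_neq0 : exists a b, a * b <> 0.

Lemma rmul0 a : a * 0 = 0.
Proof. by apply: (addIr (a * 0)); rewrite -mulDr !add0r. Qed.

Lemma lmul0 a : 0 * a = 0.
Proof. by apply: (addIr (0 * a)); rewrite -mulDl !add0r. Qed.

Lemma rmulN a x : a * (- x) = - (a * x).
Proof. by apply/eqP; rewrite -addr_eq0 -mulDr addNr rmul0. Qed.

Lemma lmulN a x : (- a) * x = - (a * x).
Proof. by apply/eqP; rewrite -addr_eq0 -mulDl addNr lmul0. Qed.

Lemma rmulMn a x n : a * (x *+ n) = (a * x) *+ n.
Proof. by elim: n => [|n IH]; rewrite ?rmul0 // !mulrS mulDr IH. Qed.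

Lemma lmulMn a x n : (a *+ n) * x = (a * x) *+ n.
Proof. by elim: n => [|n IH]; rewrite ?lmul0 // !mulrS mulDl IH. Qed.

Lemma mul_gt0_inj a x : 0 < a -> 0 < x -> a * x <> 0 -> 0 < a * x.
Proof.
move=> a0 x0 ax; have [l|/esym//|//] := lt_tot lt_linear (a * x) 0.
by case: (mul_ge0 (lt_asym lt_linear a0) (lt_asym lt_linear x0)).
Qed.

Lemma exists_mul_gt0 a : 0 < a -> (exists x, a * x <> 0) ->
  exists2 z, 0 < z & 0 < a * z.
Proof.
move=> a0 [x ax]; have [x0|x0|x0] := lt_tot lt_linear x 0.
- have Nx0 : 0 < - x by apply/(opp_pos ltD2).
  exists (- x) => //; apply: mul_gt0_inj => //.
  by rewrite rmulN => /eqP; rewrite oppr_eq0 => /eqP.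
- by case: ax; rewrite x0 rmul0.
- by exists x => //; apply: mul_gt0_inj.
Qed.

Lemma mul_mono a x y : 0 < a -> x < y -> ~ a * y < a * x.
Proof.
move=> a0 xy; rewrite -(sub_pos ltD2) -rmulN -mulDr.
have {}xy : 0 < y - x by apply/(sub_pos ltD2).
rewrite -opprB rmulN (opp_pos ltD2).
by apply: mul_ge0; apply: (lt_asym lt_linear).
Qed.

Lemma mulrn_nlt (x : V) n : 0 < x -> (0 < n)%N -> ~ x *+ n < x.
Proof.
case: n => // -[|n] x0 _; first by rewrite mulr1n; apply: (ltxx lt_linear).
apply: (lt_asym lt_linear); rewrite mulrS; apply: (ltDpos ltD2).
exact: mulrn_pos.
Qed.

(** The groups (n^i a)R for varying i are cofinal in the same cut C0, so by
    pigeonhole (n^i a)R and (n^j a)R have the same germ for some i < j.  A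
    subgroup is recovered from its germ, as the differences of elements near the
    cut; so n^i (aR) = n^j (aR), and torsion-freeness cancels n^i. *)
Lemma image_divisible a : 0 < a -> (exists x, a * x <> 0) ->
  forall n x, (0 < n)%N -> exists y, a * x = a * (y *+ n).
Proof.
move=> a0 /(exists_mul_gt0 a0)[z z0 az0] n x n0.
have dF : drel D (fun x b => exists y, x = b * y) by definability.
pose C0 u := exists y, u < a * y.
have C0mul w : C0 (a * w) by exists (w + z); rewrite mulDr; apply: (ltDpos ltD2).
have [||S [t tP]] := finitely_many_germs lt_linear D_tame (C0 := C0) dF.
- by exists (a * z).
- by move=> u v [y vy] uv; exists y; apply: (lt_tr lt_linear uv vy).
have [i [j [ij _ E]]] := pigeonhole_nat (fun i => t (a *+ (n ^ i))).
have [c C0c cP] := tP _ _ E.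
have cofinal u N : C0 u -> (0 < N)%N -> exists y, u < (a *+ N) * y.
  move=> [y uy] N0; have [y0|y0|y0] := lt_tot lt_linear (a * y) 0.
  - exists z; rewrite lmulMn; apply: (lt_tr lt_linear uy); apply: (lt_tr lt_linear y0).
    exact: mulrn_pos.
  - exists z; rewrite lmulMn; apply: (lt_tr lt_linear uy); rewrite y0.
    exact: mulrn_pos.
  - exists y; rewrite lmulMn; apply: (lt_nlt_tr lt_linear uy).
    exact: mulrn_nlt.
pose h := (a *+ (n ^ i)) * x.
have C0ch : C0 (c - h).
  have [y cy] := C0c; exists (y - x *+ (n ^ i)).
  by rewrite mulDr rmulN rmulMn /h lmulMn; apply: ltD2.
have [c' [C0c' cc' chc']] := upper_bound2 lt_linear C0c C0ch.
have nj0 : (0 < n ^ j)%N by rewrite expn_gt0 n0.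
have [y c'y] := cofinal c' (n ^ j)%N C0c' nj0.
pose g := (a *+ (n ^ j)) * y.
have C0N b N : C0 ((a *+ N) * b) by rewrite lmulMn -rmulMn.
have cg : c < g by exact: (nlt_lt_tr lt_linear cc' c'y).
have cgh : c < g + h.
  rewrite -(ltDr ltD2 (- h)) addrK; exact: (nlt_lt_tr lt_linear chc' c'y).
have [w gw] : exists w, g = (a *+ (n ^ i)) * w.
  by apply/(cP g (C0N _ _) cg); exists y.
have [v ghv] : exists v, g + h = (a *+ (n ^ j)) * v.
  have C0gh : C0 (g + h) by rewrite gw -mulDr.
  by apply/(cP _ C0gh cgh); exists (w + x); rewrite gw mulDr.
have hE : h = (a *+ (n ^ j)) * (v - y).
  by rewrite mulDr -ghv rmulN -/g addrC addKr.
(* n^(j-i) = n^(j-i-1) n, so this exponent leaves exactly one factor n. *)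
exists ((v - y) *+ (n ^ (j - i).-1)).
apply: (mulrn_inj lt_linear ltD2 (n := n ^ i)); first by rewrite expn_gt0 n0.
rewrite -lmulMn -/h hE lmulMn -mulrnA -expnSr prednK ?subn_gt0 //.
by rewrite rmulMn -mulrnA -expnD subnK // ltnW.
Qed.

(** Otherwise the upper end of the convex subgroup Ann(a) is a gap K, moved
    by the h with a h > 0.  Such an h splits: a h = 2 a y for some y, and then
    a y and a (h - y) are both positive. *)
Lemma annihilator_trivial a : 0 < a -> (exists x, a * x <> 0) ->
  forall x, a * x = 0 -> x = 0.
Proof.
move=> a0 ax; have [z z0 az0] := exists_mul_gt0 a0 ax.
move=> x0 ax0; apply: contrapT => x0n0.
have [p ap0 p0] : exists2 p, a * p = 0 & 0 < p.
  have [l|//|g] := lt_tot lt_linear x0 0; last by exists x0.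
  by exists (- x0); [rewrite rmulN ax0 oppr0 | apply/(opp_pos ltD2)].
pose K y := exists c, a * c = 0 /\ y < c.
have dK : dset D K by rewrite /K; definability.
have K0 : K 0 by exists p.
have nK w : 0 < a * w -> ~ K w.
  by move=> aw [c [ac wc]]; apply: (mul_mono a0 wc); rewrite ac.
have movesK w : 0 < a * w -> moves K w by exists 0; rewrite add0r; split; [|exact: nK].
apply: (no_gap lt_linear ltD2 dadd D_tame dK).
- by move=> x y [c [ac yc]] xy; exists c; split=> //; exact: (lt_tr lt_linear xy yc).
- by exists z; apply: movesK.
- move=> x [c [ac xc]]; exists c; split=> //; exists (c + p); split.
    by rewrite mulDr ac ap0 addr0.
  exact: (ltDpos ltD2).
- move=> x nKx; exists (x - p); split.
    by rewrite -(ltDr ltD2 p) subrK; exact: (ltDpos ltD2).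
  move=> [c [ac xpc]]; apply: nKx; exists (c + p); split.
    by rewrite mulDr ac ap0 addr0.
  by rewrite -(ltDr ltD2 (- p)) addrK.
- move=> h [k [[c [ac kc]] nKkh]].
  have [y ahy] := image_divisible a0 ax h (isT : (0 < 2)%N).
  have h0 : 0 < h.
    have [l|E|//] := lt_tot lt_linear h 0; case: nKkh; exists c; split=> //.
      exact: (lt_tr lt_linear (ltDneg ltD2 k l) kc).
    by rewrite E addr0.
  have ah0 : 0 < a * h.
    apply: mul_gt0_inj => // E; apply: nKkh; exists (c + h); split.
      by rewrite mulDr ac E addr0.
    exact: ltD2.
  have ay0 : 0 < a * y.
    rewrite ahy rmulMn mulr2n in ah0.
    have [l|E|//] := lt_tot lt_linear (a * y) 0; exfalso.
      apply: (lt_asym lt_linear ah0); apply: (lt_tr lt_linear _ l).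
      exact: (ltDneg ltD2).
    by move: ah0; rewrite E addr0; apply: (ltxx lt_linear).
  exists y; split; apply: movesK => //.
  by rewrite mulDr rmulN ahy mulr2n mulDr addrK.
Qed.

Lemma exists_pos_multiplier : exists2 a, 0 < a & exists x, a * x <> 0.
Proof.
have [a [x ax]] := mul_neq0; have [a0|a0|a0] := lt_tot lt_linear a 0.
- exists (- a); first by apply/(opp_pos ltD2).
  by exists x; rewrite lmulN => /eqP; rewrite oppr_eq0 => /eqP.
- by case: ax; rewrite a0 lmul0.
- by exists a => //; exists x.
Qed.

Lemma ring_divisible : divisible V.
Proof.
move=> n x n0; have [a a0 ax] := exists_pos_multiplier.
have [y axy] := image_divisible a0 ax x n0; exists y.
apply/eqP; rewrite -subr_eq0; apply/eqP; apply: (annihilator_trivial a0 ax).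
by rewrite mulDr rmulN axy subrr.
Qed.

Lemma ring_nontrivial : exists x : V, x <> 0.
Proof. by have [a [x ax]] := mul_neq0; exists (a * x). Qed.

Lemma ring_subgroup_trivial H : dset D H -> subgroup H ->
  (exists2 h, H h & h <> 0) -> forall x, H x.
Proof.
exact: (definable_subgroup_trivial lt_linear ltD2 dlt dadd D_tame ring_divisible).
Qed.

(** The left annihilator of R is a definable subgroup, and not all of R. *)
Lemma exists_mul_neq0 a : a <> 0 -> exists x, a * x <> 0.
Proof.
move=> a0; apply: contrapT => H.
pose Z b := forall x, b * x = 0.
have dZ : dset D Z by rewrite /Z; definability.
have subZ : subgroup Z.
  split=> [x y Zx Zy u|x Zx u]; first by rewrite mulDl Zx Zy addr0.
  by rewrite lmulN Zx oppr0.
have Z_all := ring_subgroup_trivial dZ subZ.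
have [b [x bx]] := mul_neq0; apply: bx; apply: Z_all; exists a => // u.
by apply: contrapT => au; apply: H; exists u.
Qed.

Lemma mul_surj a y : a <> 0 -> exists x, y = a * x.
Proof.
move=> a0; pose H y := exists x, y = a * x.
have dH : dset D H by rewrite /H; definability.
have subH : subgroup H.
  split=> [_ _ [x ->] [x' ->]|_ [x ->]]; first by exists (x + x'); rewrite mulDr.
  by exists (- x); rewrite rmulN.
apply: (ring_subgroup_trivial dH subH).
by have [x ax] := exists_mul_neq0 a0; exists (a * x) => //; exists x.
Qed.

(** With a e = a, the element e fixes a on the right, hence everything.
    Each remaining law is, with the other variables fixed, the statement that a
    definable subgroup is everything, and it holds at e. *)
Theorem ring_is_field : exists e,
  [/\ associative mul, commutative mul, left_id e mul, e <> 0
    & forall a, a <> 0 -> exists x, x * a = e].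
Proof.
have [a a0] := ring_nontrivial; have [e aE] := mul_surj a a0.
have e0 : e <> 0 by move=> E; rewrite E rmul0 in aE.
have ringid (P : V -> Prop) : dset D P -> subgroup P -> P e -> forall x, P x.
  by move=> dP sP Pe; apply: ring_subgroup_trivial => //; exists e.
have re x : x * e = x.
  have dP : dset D (fun x => x * e = x) by definability.
  apply: (ring_subgroup_trivial dP); last by exists a.
  by split=> [u v|u] Eu; rewrite ?mulDl ?lmulN ?Eu // => ->.
have le x : e * x = x.
  apply: (ringid (fun x => e * x = x)); rewrite ?re //; first by definability.
  by split=> [u v|u] Eu; rewrite ?mulDr ?rmulN ?Eu // => ->.
have assoc x y z : x * (y * z) = (x * y) * z.
  apply: (ringid (fun x => x * (y * z) = (x * y) * z)); rewrite ?le //.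
    by definability.
  by split=> [u v|u] Eu; rewrite ?mulDl ?lmulN ?mulDl ?lmulN ?Eu // => ->.
have comm x y : x * y = y * x.
  apply: (ringid (fun x => x * y = y * x)); rewrite ?le ?re //; first by definability.
  by split=> [u v|u] Eu; rewrite ?mulDr ?mulDl ?rmulN ?lmulN ?Eu // => ->.
exists e; split=> // b b0; have [x bx] := mul_surj e b0.
by exists x; rewrite comm.
Qed.

Lemma mul_gt0 x y : 0 < x -> 0 < y -> 0 < x * y.
Proof.
move=> x0 y0; apply: mul_gt0_inj => // E.
have xn0 : x <> 0 by move=> Ex; rewrite Ex in x0; apply: (ltxx lt_linear x0).
have := annihilator_trivial x0 (exists_mul_neq0 xn0) E.
by move=> Ey; rewrite Ey in y0; apply: (ltxx lt_linear y0).
Qed.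

End TameRing.

(** * Tame ordered fields *)

Lemma List_In_mem (T : eqType) (s : seq T) x : List.In x s <-> x \in s.
Proof.
elim: s => //= y s IH; rewrite inE IH.
by split=> [[->|->]|/orP[/eqP->|]]; rewrite ?eqxx ?orbT; auto.
Qed.

Section TameField.
Local Open Scope ring_scope.
Import Order.TTheory GRing.Theory Num.Theory.
Variables (F : realFieldType) (D : definability F).
Let lt (x y : F) : Prop := x < y.
Hypothesis dlt : drel D lt.
Hypothesis dadd : dop D (fun x y : F => x + y).
Hypothesis dmul : dop D (fun x y : F => x * y).
Hypothesis D_tame : tame D lt.
Hypothesis D_complete : definably_complete D lt.
Hypothesis D_eventually_constant : eventually_constant D lt.

Lemma dun_horner (p : {poly F}) : dun D (horner p).
Proof.
elim/poly_ind: p => [|p c IH].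
  by apply: dpred_ext (dfun_const D 1 (0 : F)) => e; rewrite horner0.
have d : dun D (fun x => horner p x * x + c) by rewrite /dun; definability.
by apply: dpred_ext d => e; rewrite hornerMXaddC.
Qed.

(** p - p(s) is X - s times a polynomial, which is bounded near s. *)
Lemma horner_near (p : {poly F}) s e : 0 < e ->
  exists2 d, 0 < d & forall x, `|x - s| < d -> `|p.[x] - p.[s]| < e.
Proof.
move=> e0; have /factor_theorem[q pq] : root (p - p.[s]%:P) s.
  by rewrite rootE !hornerE subrr.
have [ub ubP] := poly_itv_bound q (s - 1) (s + 1).
have ub1 : 0 < `|ub| + 1 by rewrite ltr_pwDr.
exists (Num.min 1 (e / (`|ub| + 1))); first by rewrite lt_min ltr01 divr_gt0.
move=> x; rewrite lt_min => /andP[x1 xe].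
have -> : p.[x] - p.[s] = q.[x] * (x - s).
  by have := congr1 (horner^~ x) pq; rewrite !hornerE.
have qx : `|q.[x]| < `|ub| + 1.
  have /ubP h : s - 1 <= x <= s + 1 by move: x1; rewrite ltr_norml => /andP[? ?]; lra.
  by apply: (le_lt_trans h); apply: (le_lt_trans (ler_norm ub)); rewrite ltrDl.
rewrite normrM; have [->|xs] := eqVneq (x - s) 0; first by rewrite normr0 mulr0.
apply: (@lt_trans _ _ ((`|ub| + 1) * `|x - s|)); first by rewrite ltr_pM2r ?normr_gt0.
by rewrite mulrC -ltr_pdivlMr.
Qed.

(** The zero is the supremum of the points below some y <= b with
    p(y) <= 0. *)
Theorem intermediate_value : Num.real_closed_axiom F.
Proof.
move=> p a b ab /andP[pa pb].
pose K x := exists y, [/\ x <= y, y <= b & p.[y] <= 0].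
have dK : dset D K.
  have dp := dun_horner p.
  have : dset D (fun x => exists y, ~ lt y x /\ ~ lt b y /\ ~ lt 0 (horner p y)).
    by definability.
  apply: dpred_ext => e; split=> [[y [/negP h1 [/negP h2 /negP h3]]]|[y [h1 h2 h3]]].
    by exists y; rewrite !leNgt.
  by exists y; rewrite /lt; split; [|split]; apply/negP; rewrite -leNgt.
have [||x y [z [yz zb pz]] xy|s [s1 s2]] := D_complete dK.
- by exists a, a; split.
- by exists (b + 1) => -[y [by1 yb _]]; lra.
- by exists z; split=> //; apply: le_trans yz; apply: ltW.
have sb : s <= b.
  rewrite leNgt; apply/negP => bs.
  by have /s1[y [h1 h2 _]] : lt ((b + s) / 2) s; rewrite /lt; lra.
have as_ : a <= s.
  by rewrite leNgt; apply/negP => /s2; apply; exists a.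
exists s; first by rewrite as_.
apply/rootP; apply/eqP; rewrite eq_le.
apply/andP; split; rewrite leNgt; apply/negP => ps.
- have [d d0 dP] := horner_near p s ps.
  have /s1[y [h1 h2 h3]] : lt (s - d / 2) s by rewrite /lt; lra.
  have ys : y <= s.
    rewrite leNgt; apply/negP => sy; have : lt s ((s + y) / 2) by rewrite /lt; lra.
    by move/s2; apply; exists y; split=> //; lra.
  have : `|y - s| < d by rewrite ltr_norml; lra.
  by move/dP; rewrite ltr_norml => /andP[]; lra.
- have Nps : 0 < - p.[s] by rewrite oppr_gt0.
  have [d d0 dP] := horner_near p s Nps.
  have sltb : s < b.
    by rewrite lt_neqAle sb andbT; apply/eqP => E; move: ps; rewrite E ltNge pb.
  pose y := Num.min b (s + d / 2).
  have sy : s < y by rewrite lt_min sltb; lra.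
  have [yb ysd] : y <= b /\ y <= s + d / 2 by split; rewrite ge_min lexx ?orbT.
  have : `|y - s| < d by rewrite ltr_norml; lra.
  move/dP; rewrite ltr_norml => /andP[_ py].
  apply: (s2 ((s + y) / 2)); first by rewrite /lt; lra.
  by exists y; split=> //; lra.
Qed.

(** In the coordinate u = 1/(x - a), approaching a from the right means tending
    to infinity. *)
Lemma constant_on_the_right A : dset D A -> forall a,
  exists2 e, 0 < e & forall x y, a < x < a + e -> a < y < a + e -> A x -> A y.
Proof.
move=> dA a.
pose A' u := exists z, z * u = 1 /\ A (a + z).
have [|c cP] := D_eventually_constant (A := A'); first by rewrite /A'; definability.
pose M := Num.max c 1; have M0 : 0 < M by rewrite lt_max ltr01 orbT.
exists M^-1; first by rewrite invr_gt0.
have big x : a < x < a + M^-1 -> c < (x - a)^-1.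
  move=> /andP[ax xa]; apply: (@le_lt_trans _ _ M); first by rewrite le_max lexx.
  by rewrite -[M]invrK ltf_pV2 ?posrE ?invr_gt0 //; lra.
have A'E x : a < x -> A' (x - a)^-1 <-> A x.
  move=> ax; have xa : x - a != 0 by rewrite subr_eq0 gt_eqF.
  split=> [[z [/(canRL (mulfVK xa))]]|Ax].
    by rewrite mul1r => ->; rewrite addrC subrK.
  by exists (x - a); rewrite mulfV // addrC subrK.
move=> x y axe aye Ax.
have [ax _] := andP axe; have [ay _] := andP aye.
by apply/(A'E y ay); apply: (cP (x - a)^-1); [exact: big|exact: big|exact/A'E].
Qed.

Definition boundary (A : F -> Prop) (b : F) :=
  ~ exists e, 0 < e /\ forall y, b < y + e -> y < b + e -> (A y <-> A b).

Lemma dset_boundary A : dset D A -> dset D (boundary A).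
Proof.
move=> dA; rewrite /boundary.
have : dset D (fun b => ~ exists e, lt 0 e /\ forall y, lt b (y + e) ->
   lt y (b + e) -> (A y <-> A b)) by definability.
by [].
Qed.

Lemma boundary_isolated A : dset D A -> forall a,
  exists2 e, 0 < e & forall b, a < b < a + e -> ~ boundary A b.
Proof.
move=> dA a; have [e e0 eP] := constant_on_the_right dA a.
exists e => // b /andP[ab be]; apply; pose r := Num.min (b - a) (a + e - b).
have [r1 r2] : r <= b - a /\ r <= a + e - b by split; rewrite ge_min lexx ?orbT.
exists r; split; first by rewrite lt_min; lra.
by move=> y h1 h2; split; apply: eP; lra.
Qed.

(** Otherwise the supremum of the z such that the set contains [x, z] is a point
    where it is not locally constant. *)
Lemma constant_between A x y : dset D A -> x < y ->
  (forall t, x <= t <= y -> ~ boundary A t) -> A x <-> A y.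
Proof.
move=> dA xy nb.
suff main B : dset D B -> (forall t, x <= t <= y -> ~ boundary B t) -> B x -> B y.
  split; first exact: main.
  move=> Ay; apply: contrapT => nAx.
  have: ~ A y; last by apply.
  apply: (main (fun t => ~ A t)) => //; first by definability.
  move=> t xty; have := nb t xty; apply: contra_not => H [e [e0 eP]].
  by apply: H; exists e; split=> // z h1 h2; rewrite (eP z h1 h2).
move=> {A dA nb} dB nb Bx; apply: contrapT => nBy.
pose K z := z < x \/ forall t, ~ t < x -> ~ z < t -> B t.
have dK : dset D K.
  have : dset D (fun z => lt z x \/ forall t, ~ lt t x -> ~ lt z t -> B t).
    by definability.
  by [].
have [||z w Kw zw|s [s1 s2]] := D_complete dK.
- by exists (x - 1); left; lra.
- exists y => -[|/(_ y) By]; first lra.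
  by apply: nBy; apply: By; apply/negP; rewrite -leNgt // ltW.
- case: Kw => [wx|Kw]; [left|right => t tx zt]; first exact: lt_trans wx.
  by apply: Kw => // wt; apply: zt; apply: lt_trans wt.
have xs : x <= s.
  rewrite leNgt; apply/negP => sx.
  by case: (s2 ((s + x) / 2)); [rewrite /lt | left]; lra.
have sy : s <= y.
  rewrite leNgt; apply/negP => /s1[|/(_ y)Ky]; first lra.
  by apply/nBy/Ky; apply/negP; rewrite -leNgt // ltW.
have [e [e0 eP]] : exists e, 0 < e /\ forall t, s < t + e -> t < s + e -> (B t <-> B s).
  by apply: contrapT; apply: nb; rewrite xs.
have Bs : B s.
  have [E|sx] := eqVneq s x; first by rewrite E.
  have xlts : x < s by rewrite lt_neqAle xs eq_sym sx.
  pose t := Num.max x (s - e / 2).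
  have ts : t < s by rewrite gt_max xlts; lra.
  have [xt ste] : x <= t /\ s - e / 2 <= t by split; rewrite le_max lexx ?orbT.
  have Bt : B t.
    by have [tx|] := s1 t ts; [lra|apply; apply/negP; rewrite -leNgt].
  by apply/(eP t) => //; lra.
have /s2 : lt s (s + e / 2) by rewrite /lt; lra.
apply; right => t /negP; rewrite -leNgt => xt /negP; rewrite -leNgt => te.
have [st|ts] := leP s t; first by apply/(eP t) => //; lra.
have [tx|] := s1 t ts; [lra|apply; apply/negP; rewrite -leNgt //].
Qed.

(** Radii valid for each of finitely many conditions have a common refinement. *)
Lemma common_radius (T : eqType) (s : seq T) (P : T -> F -> Prop) :
  (forall x e e', 0 < e' -> e' <= e -> P x e -> P x e') ->
  (forall x, x \in s -> exists2 e, 0 < e & P x e) ->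
  exists2 e, 0 < e & forall x, x \in s -> P x e.
Proof.
move=> Pmono; elim: s => [|x s IH] H; first by exists 1.
have [e e0 eP] := H x (mem_head x s).
have [|d d0 dP] := IH; first by move=> y ys; apply: H; rewrite inE ys orbT.
have m0 : 0 < Num.min e d by rewrite lt_min e0.
exists (Num.min e d) => // y; rewrite inE => /orP[/eqP->|ys].
  by apply: Pmono eP; rewrite // ge_min lexx.
by apply: Pmono (dP y ys); rewrite // ge_min lexx orbT.
Qed.

Lemma enumerate_bounded (T : eqType) (B : T -> Prop) m :
  (forall s, uniq s -> (forall b, b \in s -> B b) -> (size s <= m)%N) ->
  exists s : seq T, forall b, B b -> b \in s.
Proof.
move=> H; apply: contrapT => /forallNP N.
suff [s [us sB szs]] : exists s : seq T,
    [/\ uniq s, forall b, b \in s -> B b & size s = m.+1].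
  by have := H s us sB; rewrite szs ltnn.
elim: m.+1 {H} => [|k [s [us sB szs]]]; first by exists [::].
have /existsNP[b /not_implyP[Bb /negP bs]] := N s.
exists (b :: s); split; rewrite /= ?bs ?szs //.
by move=> x; rewrite inE => /orP[/eqP->|/sB].
Qed.

Lemma colour_constant_on_the_right (C : finType) (tau : F -> C) :
  (forall c, dset D (fun x => tau x = c)) -> forall a,
  exists2 e, 0 < e & forall x y, a < x < a + e -> a < y < a + e -> tau x = tau y.
Proof.
move=> dtau a.
have [||e e0 eP] := @common_radius C (enum C) (fun c e => forall x y,
    a < x < a + e -> a < y < a + e -> tau x = c -> tau y = c).
- by move=> c e e' _ ee H x y xe ye; apply: H; lra.
- by move=> c _; exact: constant_on_the_right (dtau c) a.
by exists e => // x y xe ye; symmetry; apply: (eP (tau x)) xe ye _; rewrite ?mem_enum.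
Qed.

(** Let d be a radius on which the colouring is constant to the right of m + 1
    boundary points b, and shift the boundary by d/2.  The m cut points
    of this shifted set miss some b + d/2, so membership in the shifted
    boundary is constant on a small interval to the right of b + d/2, starting
    at b + d/2 itself.  But b is isolated on the right in the boundary. *)
Lemma finite_boundary A : dset D A ->
  exists s : seq F, forall b, boundary A b -> b \in s.
Proof.
move=> dA; have dB := dset_boundary dA.
have dshift : drel D (fun x a => exists b, b + a = x /\ boundary A b) by definability.
have [C [tau [m [dtau tauP]]]] := D_tame dshift.
apply: (enumerate_bounded (m := m)) => bs ubs bsB; rewrite leqNgt; apply/negP => szbs.
have [||d d0 dP] := @common_radius F bs (fun b e => forall x y,
    b < x < b + e -> b < y < b + e -> tau x = tau y).
- by move=> b e e' _ ee H x y xe ye; apply: H; lra.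
- by move=> b _; exact: colour_constant_on_the_right.
pose a : F := d / 2; have [zs szs zsP] := tauP a.
have [b [bbs ba_zs]] : exists b, b \in bs /\ b + a \notin zs.
  apply: contrapT => H; have: (size [seq b + a | b <- bs]%R <= size zs)%N.
    apply: uniq_leq_size; first by rewrite map_inj_uniq //; apply: addIr.
    move=> _ /mapP[b bbs ->]; apply: contrapT => /negP bazs; apply: H.
    by exists b.
  rewrite size_map leqNgt => /negP; apply; exact: leq_ltn_trans szbs.
have [e e0 eP] := boundary_isolated dA b.
have [||r r0 rP] := @common_radius F zs (fun z r => b + a < z -> b + a + r <= z).
- by move=> z r r' _ rr H /H; lra.
- move=> z _; have [bz|zb] := ltP (b + a) z; last by exists 1 => //; lra.
  by exists (z - (b + a)); lra.
pose r' := Num.min (Num.min e r) (d / 2) / 2.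
have [r'0 r'e r'r r'd] : [/\ 0 < r', r' < e, r' < r & r' < d / 2].
  have m0 : 0 < Num.min (Num.min e r) (d / 2) by rewrite !lt_min e0 r0; lra.
  have : Num.min (Num.min e r) (d / 2) <= e by rewrite !ge_min lexx.
  have : Num.min (Num.min e r) (d / 2) <= r by rewrite !ge_min lexx orbT.
  have : Num.min (Num.min e r) (d / 2) <= d / 2 by rewrite ge_min lexx orbT.
  by rewrite /r'; split; lra.
have ba_shift : exists b', b' + a = b + a /\ boundary A b'.
  by exists b; split=> //; apply: bsB.
have [||b' [bE Bb']] := zsP (b + a) (b + a + r') _ _ ba_shift.
- by apply: (dP b bbs); rewrite /a; lra.
- move=> z /List_In_mem zzs; have nz : b + a != z by apply: contraNneq ba_zs => ->.
  have [bz|zb] := ltP (b + a) z.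
    have bz' : b + a + r' < z by have := rP z zzs bz; lra.
    by rewrite /lt bz bz'; split=> //; split=> E; [move: bz|move: bz']; rewrite E ltxx.
  have {}zb : z < b + a by rewrite lt_neqAle eq_sym nz.
  have zb' : z < b + a + r' by lra.
  rewrite /lt (lt_gtF zb) (lt_gtF zb'); split=> //.
  by split=> E; [move: zb|move: zb']; rewrite E ltxx.
by apply: (eP b') Bb'; lra.
Qed.

Theorem tame_same_side A : dset D A ->
  exists s, forall x y, same_side lt s x y -> A x -> A y.
Proof.
move=> dA; have [s sP] := finite_boundary dA; exists s.
suff main x y : x < y -> same_side lt s x y -> A x <-> A y.
  move=> x y sxy; have [xy|yx|->//] := ltgtP x y; first exact: (main x y xy sxy).1.
  apply: (main y x yx _).2 => z /sxy[-> ->] //.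
move=> xy sxy; apply: (constant_between dA xy) => t /andP[xt ty] /sP/List_In_mem ts.
have [h1 h2] := sxy t ts.
have [E|nxt] := eqVneq x t.
  by move: xy; rewrite (proj1 h2 E) E ltxx.
have /h1 : x < t by rewrite lt_neqAle nxt.
by rewrite /lt ltNge ty.
Qed.

End TameField.

(** * Boolean combinations of intervals *)

Section Intervals.
Variables (T : Type) (lt : T -> T -> Prop).
Local Open Scope classical_set_scope.

Lemma boolean_combinationI (G : set (set T)) A B : boolean_combination G A ->
  boolean_combination G B -> boolean_combination G (A `&` B).
Proof.
move=> bA bB; rewrite -[A `&` B]setCK setCI.
by apply: BC_setC; apply: BC_setU; apply: BC_setC.
Qed.

Lemma boolean_combinationS (G G' : set (set T)) A : G `<=` G' ->
  boolean_combination G A -> boolean_combination G' A.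
Proof.
move=> GG'; elim=> {A} [A /GG'|||]; first exact: BC_gen.
- exact: BC_setT.
- by move=> A _; apply: BC_setC.
- by move=> A B _ bA _; apply: BC_setU.
Qed.

Hypothesis lt_linear : linear_order lt.

(** Induction on the endpoints: on each of the three pieces x < z, x = z and
    z < x, the set agrees with its saturation [near] under the
    remaining endpoints. *)
Lemma same_side_boolean_combination s (A : set T) :
  (forall x y, same_side lt s x y -> A x -> A y) ->
  boolean_combination (is_interval lt) A.
Proof.
elim: s A => [|z s IH] A HA.
  have [[x Ax]|A0] := pselect (exists x, A x).
    by rewrite (_ : A = setT); [exact: BC_setT|rewrite predeqE => y; split=> // _;
      apply: HA Ax].
  rewrite (_ : A = ~` setT); first exact/BC_setC/BC_setT.
  by rewrite predeqE => y; split=> [Ay|/(_ I)//]; case: A0; exists y.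
have [irr tr tot] := lt_linear.
pose near (P : set T) : set T := [set x | exists y, [/\ P y, A y & same_side lt s y x]].
have bnear P : boolean_combination (is_interval lt) (near P).
  apply: IH => x y sxy [w [Pw Aw swx]]; exists w; split=> // t ts.
  by have [-> ->] := swx t ts; apply: sxy.
have nearE (P : set T) :
    (forall x y, P x -> P y -> (lt x z <-> lt y z) /\ (x = z <-> y = z)) ->
    forall x, P x -> near P x -> A x.
  by move=> HP x Px [y [Py Ay sxy]]; apply: HA Ay => t [<-|/sxy//]; apply: HP.
pose L : set T := [set x | lt x z]; pose E : set T := [set x | x = z].
pose G : set T := [set x | lt z x].
have -> : A = (L `&` near L) `|` (E `&` near E) `|` (G `&` near G).
  rewrite predeqE => x; split=> [Ax|[[[Px nx]|[Px nx]]|[Px nx]]].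
  - by case: (tot x z) => xz; [left;left|left;right|right]; split=> //; exists x.
  - apply: nearE nx => // a b La Lb; split=> //.
    by split=> ab; [move: La|move: Lb]; rewrite /L /= ab => /irr.
  - by apply: nearE nx => // a b -> ->.
  - have ngt a : G a -> (lt a z <-> False) /\ (a = z <-> False).
      move=> Ga; split; split=> // az; last by move: Ga; rewrite /G /= az => /irr.
      exact: irr (tr _ _ _ Ga az).
    apply: nearE nx => // a b Ga Gb.
    by have [[-> ->] [-> ->]] := (ngt a Ga, ngt b Gb).
apply: BC_setU; first apply: BC_setU.
all: apply: boolean_combinationI (bnear _); apply: BC_gen.
- exists (Infinite T), (Open z); rewrite predeqE => x /=; split=> [|[]] //.
- exists (Closed z), (Closed z); rewrite predeqE => x /=; rewrite /le /E /=.
  split=> [->|[[-> //|zx] [//|/(tr _ _ _ zx)/irr//]]]; by split; left.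
- by exists (Open z), (Infinite T); rewrite predeqE => x /=; split=> [|[]].
Qed.

End Intervals.

(** * Real closed fields *)

Section Structures.
Local Open Scope ring_scope.
Import GRing.Theory.

Lemma zmodule_of_group (T : Type) (add : T -> T -> T) (zero : T) :
  associative add -> commutative add -> left_id zero add ->
  (forall x, exists y, add y x = zero) ->
  exists c : GRing.Zmodule T, let V := GRing.Zmodule.Pack c in
    (forall x y : V, x + y = add x y) /\ (0 : V) = zero.
Proof.
move=> addA addC add0 /choice[opp addN].
pose C : choiceType := HB.pack T (gen_eqMixin T) (gen_choiceMixin T).
pose V : zmodType := HB.pack C (GRing.isZmodule.Build C addA addC add0 addN).
by exists (GRing.Zmodule.class V).
Qed.

Lemma real_field_of_ring (V : zmodType) (lt : V -> V -> Prop) (mul : V -> V -> V) e :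
  linear_order lt -> (forall x y z, lt x y -> lt (x + z) (y + z)) ->
  associative mul -> commutative mul -> left_id e mul ->
  left_distributive mul (fun x y => x + y) -> e <> 0 ->
  (forall a, a <> 0 -> exists x, mul x a = e) ->
  (forall x y, lt 0 x -> lt 0 y -> lt 0 (mul x y)) ->
  exists c : Num.RealField V, let F : realFieldType := Num.RealField.Pack c in
    [/\ forall x y : F, x + y = (x : V) + (y : V), forall x y : F, x * y = mul x y
      & forall x y : F, (x < y)%R <-> lt x y].
Proof.
(* The class of V has to be explicit for the richer structures to extend it. *)
case: V lt mul e => T c lt mul e.
set V : zmodType := GRing.Zmodule.Pack c.
move=> lin ltD mulA mulC mul1 mulDl e0 inv_ex mul_gt0.
have [irr tr tot] := lin.
have [inv [invP inv0]] : exists inv : V -> V,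
    (forall x, x != 0 -> mul (inv x) x = e) /\ inv 0 = 0.
  have /choice[f fP] x : exists y, (x <> 0 -> mul y x = e) /\ (x = 0 -> y = 0).
    have [->|x0] := pselect (x = 0); first by exists 0.
    by have [y yP] := inv_ex x x0; exists y.
  by exists f; split=> [x /eqP x0|]; [apply: (fP x).1|apply: (fP 0).2].
have e_neq0 : e != 0 by apply/eqP.
pose R1 : comNzRingType := HB.pack V
  (GRing.Zmodule_isComNzRing.Build V mulA mulC mul1 mulDl e_neq0).
pose F1 : fieldType := HB.pack R1
  (GRing.ComNzRing_isField.Build R1 invP inv0).
pose rlt (x y : V) := `[< lt x y >].
pose rle (x y : V) := (x == y) || rlt x y.
pose norm (x : V) : V := if rlt x 0 then - x else x.
have lt_irr x : rlt x x = false by apply/asboolP/irr.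
have lt_asym x y : rlt x y -> ~~ rlt y x.
  by move=> /asboolP xy; apply/asboolP => yx; apply: (irr x); apply: tr xy yx.
have lt_add (x y : V) : rlt 0 x -> rlt 0 y -> rlt 0 (x + y).
  move=> /asboolP x0 /asboolP y0; apply/asboolP; apply: tr x0 _.
  by rewrite addrC -{1}[x]add0r; apply: ltD.
have lt_mul (x y : V) : rlt 0 x -> rlt 0 y -> rlt 0 (mul x y).
  by move=> /asboolP x0 /asboolP y0; apply/asboolP/mul_gt0.
have lt_sub (x y : V) : rlt 0 (y - x) = rlt x y.
  apply/asboolP/asboolP => [/(ltD _ _ x)|/(ltD _ _ (- x))].
    by rewrite add0r subrK.
  by rewrite subrr.
have lt_total (x : V) : x != 0 -> rlt 0 x || rlt x 0.
  move=> /eqP x0; case: (tot 0 x) => [h|/esym//|h]; first by rewrite /rlt asboolT.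
  by rewrite orbC /rlt asboolT.
have ltN (x : V) : rlt (- x) 0 = rlt 0 x by rewrite -lt_sub opprK add0r.
have normN (x : V) : norm (- x) = norm x.
  rewrite /norm ltN opprK; have [->|/lt_total] := eqVneq x 0.
    by rewrite lt_irr oppr0.
  have [x0 _|_ /= ->//] := boolP (rlt 0 x).
  by rewrite (negbTE (lt_asym _ _ x0)).
have ge0_norm (x : V) : rle 0 x -> norm x = x.
  rewrite /rle /norm => /orP[/eqP <-|x0]; first by rewrite lt_irr.
  by rewrite (negbTE (lt_asym _ _ x0)).
have le_def (x y : V) : rle x y = (x == y) || rlt x y by [].
pose F : realFieldType := HB.pack F1
  (Num.IntegralDomain_isLtReal.Build F1 lt_add lt_mul (lt_asym 0) lt_sub lt_total
     normN ge0_norm le_def).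
exists (Num.RealField.class F); split=> // x y; split=> [/asboolP//|h].
exact/asboolP.
Qed.

(** The ordered field structure is kept, only the intermediate value property
    is added. *)
Lemma real_closed_field_intro (F : realFieldType) :
  Num.real_closed_axiom F ->
  real_closed_field (fun x y : F => (x < y)%R) (fun x y : F => x + y)
    (fun x y : F => x * y).
Proof.
move=> ivt.
pose G : rcfType := HB.pack F (Num.RealField_isClosed.Build F ivt).
by exists (Num.RealClosedField.class G).
Qed.

End Structures.

Theorem theorem12 (L : language) (lt : relations L 2) (add mul : functions L 2)
    (R : structure L) (zero : R)
    (R_qom : quasi_o_minimal lt R)
    (R_ring : ordered_ring (rel2 R lt) (fun2 R add) (fun2 R mul) zero)
    (mul_neq0 : exists a b : R, fun2 R mul a b <> zero) :
  real_closed_field (rel2 R lt) (fun2 R add) (fun2 R mul) /\ o_minimal lt R.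
Proof.
have [[addA addC add0 addN] [mulDl mulDr] lin ltD mul_ge0] := R_ring.
pose D := structure_definability zero.
have D_tame : tame D (rel2 R lt) := @quasi_o_minimal_tame L R zero lt R_qom.
have dlt : drel D (rel2 R lt) := drel_rel2 zero lt.
have dadd : dop D (fun2 R add) := dop_fun2 zero add.
have dmul : dop D (fun2 R mul) := dop_fun2 zero mul.
have [c [addE zeroE]] := zmodule_of_group addA addC add0 addN.
set V := GRing.Zmodule.Pack c in addE zeroE.
have addVE : (fun x y : V => (x + y)%R) = fun2 R add.
  by apply/funext => x; apply/funext => y; rewrite addE.
have VltD (x y z : V) : rel2 R lt x y -> rel2 R lt (x + z)%R (y + z)%R.
  by rewrite !addE; apply: ltD.
rewrite -addVE in dadd mulDl mulDr *.
rewrite -zeroE in mul_ge0 mul_neq0.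
have linV : @linear_order V (rel2 R lt) := lin.
have irr := ltxx linV.
have Vmul_ge0 (x y : V) : ~ rel2 R lt x (0%R : V) ->
    ~ rel2 R lt y (0%R : V) -> ~ rel2 R lt (fun2 R mul x y) (0%R : V).
  have geE u : ~ rel2 R lt u (0%R : V) -> le (rel2 R lt) (0%R : V) u.
    by move=> u0; have [//|->|] := lt_tot linV u (0%R : V); [left|right].
  move=> /geE x0 /geE y0 xy; have [E|xy'] := mul_ge0 x y x0 y0.
    by rewrite -E in xy; apply: irr xy.
  exact: (lt_asym linV xy xy').
have Vdiv := @ring_divisible V _ D linV VltD dlt dadd D_tame _
  dmul mulDl mulDr Vmul_ge0 mul_neq0.
have Vcomplete := divisible_complete linV VltD dadd D_tame Vdiv.
have Vconst := divisible_eventually_constant linV VltD dlt dadd D_tame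
  (@ring_nontrivial V _ mul_neq0) Vdiv.
have [e [mulA mulC mul1 e0 inv]] :=
  @ring_is_field V _ D linV VltD dlt dadd D_tame _ dmul mulDl mulDr Vmul_ge0 mul_neq0.
have Vmul_gt0 := @mul_gt0 V _ D linV VltD dlt dadd D_tame _
  dmul mulDl mulDr Vmul_ge0 mul_neq0.
have [c' [addF mulF ltF]] :=
  real_field_of_ring linV VltD mulA mulC mul1 mulDl e0 inv Vmul_gt0.
set F := Num.RealField.Pack c' in addF mulF ltF.
have addFE : (fun x y : F => (x + y)%R) = (fun x y : V => (x + y)%R).
  by apply/funext => x; apply/funext => y; rewrite addF.
have mulFE : (fun x y : F => (x * y)%R) = fun2 R mul.
  by apply/funext => x; apply/funext => y; rewrite mulF.
have ltFE : (fun x y : F => (x < y)%R : Prop) = rel2 R lt.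
  by apply/funext => x; apply/funext => y; apply/propext.
rewrite -ltFE in dlt D_tame Vcomplete Vconst.
rewrite -addFE in dadd *; rewrite -mulFE in dmul *.
split.
  rewrite -ltFE; apply: (@real_closed_field_intro F).
  exact: (@intermediate_value F D).
split=> // A; split=> [/(definable_dset zero) dA|bA].
  have [s sP] := @tame_same_side F D dlt dadd dmul D_tame Vcomplete Vconst A dA.
  by apply: (same_side_boolean_combination lin (s := s)); rewrite -ltFE.
have [_ qom] := R_qom; have [|_] := qom R _ A; first by [].
by apply; apply: boolean_combinationS bA => B; right.
Qed.
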